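(* Let $\{A_t\}_{t\ge0}$ be the family of self-adjoint operators $$A_t=\bigoplus_{j=1}^\infty\bigoplus_{k=1}^\infty R_{jk}^{(t)},\quad t\ge0,$$ where the operators $R_{jk}^{(t)}$ are as defined in the context. Then the operators $A_t$, $t\ge0$, are pairwise unitarily equivalent. Each operator $A_t$ has purely point spectrum. Moreover, for every continuous function $f$ on $\mathbb R$, $$\|f(A_t)-f(A_0)\|=\Omega_f(t),\quad t>0.$$
   Context: Operator modulus of continuity: for a continuous function $f$ on $\mathbb R$ and $\delta>0$, $\Omega_f(\delta)=\sup\|f(A)-f(B)\|$, the supremum being taken over all bounded self-adjoint operators $A$ and $B$ on Hilbert space with $\|A-B\|\le\delta$ (the value $+\infty$ is allowed). Construction: Let $\mathfrak K$ be the set of finite rank self-adjoint operators on a (separable infinite-dimensional) Hilbert space and let $\mathfrak K_0$ be a countable dense subset of $\mathfrak K$ (in the operator norm). Let $\{R_j\}_{j=1}^\infty$ be an enumeration of $\mathfrak K_0$. For $j\ge1$ and $t>0$ put $\mathfrak K_{jt}=\{A\in\mathfrak K_0:\ \|A-R_j\|<t\}$ and let $\{R_{jk}^{(t)}\}_{k=1}^\infty$ be an enumeration of $\mathfrak K_{jt}$. For $t=0$ put $R_{jk}^{(0)}=R_j$ for all $j,k\ge1$. The operators $A_t$ are (unbounded) self-adjoint orthogonal sums. The operator $f(A_t)-f(A_0)$ is the orthogonal sum of the operators $f(R_{jk}^{(t)})-f(R_{jk}^{(0)})$, and its norm is $+\infty$ if it is unbounded. Purely point spectrum means that there is an orthonormal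 basis of eigenvectors. *)

(* Defs.v *)
From HB Require Import structures.
From mathcomp Require Import all_boot all_order all_algebra.
From mathcomp Require Import sesquilinear.
From mathcomp Require Import all_classical all_reals ereal topology normedtype sequences.
From mathcomp Require Import complex lra.
Import Order.TTheory GRing.Theory Num.Theory.
Import numFieldNormedType.Exports.
Set Implicit Arguments.
Unset Strict Implicit.
Unset Printing Implicit Defensive.
Local Open Scope classical_set_scope.
Local Open Scope complex_scope.
Local Open Scope ring_scope.

(* A complex Hilbert space; the inner product is linear in its first argument
   and conjugate-linear in its second. *)
Record hilbert (R : realType) := Hilbert {
  hspace :> completeNormedModType R[i];
  inner : {dot hspace for @Num.conj R[i]};
  hnormE : forall x : hspace, `|x| ^+ 2 = inner x x
}.

Section DotNorm.
Variables (C : numClosedFieldType) (U : lmodType C) (form : {dot U for @Num.conj C}).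
Local Notation "''[' u , v ]" := (form u%R v%R) : ring_scope.
Local Notation "''[' u ]" := '[u, u]%R : ring_scope.

Lemma dot_CauchySchwarz (u v : U) : `|'[u, v]| ^+ 2 <= '[u] * '[v].
Proof.
have [-> | nz_v] := eqVneq v 0.
  rewrite !linear0r normr0 expr0n /=.
  by apply: mulr_ge0; [exact: dnorm_ge0|exact: lexx].
pose a := '[u, v] / '[v]; pose u1 := u - a *: v.
have ou : '[u1, v] = 0.
  by rewrite linearBl /= linearZl_LR divfK ?dnorm_eq0 ?subrr//.

have -> : u = u1 + a *: v by rewrite subrK.
rewrite linearDl /= ou add0r linearZl_LR /= normrM (ger0_norm (dnorm_ge0 _ _)).
rewrite exprMn [X in _ <= X * _]hnormDd /=; last by rewrite linearZr_LR /= ou mulr0.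
by rewrite dnormZ mulrDl expr2 !mulrA lerDr mulr_ge0.
Qed.

Lemma dot_triangle (u v : U) : sqrtC '[u + v] <= sqrtC '[u] + sqrtC '[v].
Proof.
rewrite -ler_sqr ?rpredD ?nnegrE ?sqrtC_ge0 ?addr_ge0 ?sqrtC_ge0//.
rewrite sqrrD !sqrtCK addrAC dnormD lerD2l.
rewrite -mulr_natr -[_ + _](divfK (negbT (pnatr_eq0 C 2))) -/('Re _).
rewrite ler_pM2r ?ltr0n//.
have := (leif_Re_Creal '[u, v]).1; rewrite -ReE => /le_trans; apply.
rewrite -(sqrCK (normr_ge0 _)) -sqrtCM ?nnegrE//.
by rewrite ler_sqrtC ?nnegrE ?mulr_ge0 ?exprn_ge0 ?dot_CauchySchwarz.
Qed.
End DotNorm.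

Section Complex.
Variable R : realType.
Local Notation C := R[i].
Definition nrm (V : normedModType C) (x : V) : R := complex.Re `|x|.

Lemma nrmE (V : normedModType C) (x : V) : `|x| = (nrm x)%:C.
Proof.
rewrite /nrm [LHS]complexE (ger0_Im (normr_ge0 x)).
by rewrite rmorph0 mulr0 addr0.
Qed.

Lemma nrm_ge0 (V : normedModType C) (x : V) : 0 <= nrm x.
Proof. by rewrite -ler0c -nrmE. Qed.

Lemma nrmD (V : normedModType C) (x y : V) : nrm (x + y) <= nrm x + nrm y.
Proof. by rewrite -lecR rmorphD /= -!nrmE ler_normD. Qed.

Lemma nrmZ (V : normedModType C) (a : C) (x : V) : nrm (a *: x) = complex.Re `|a| * nrm x.
Proof.
apply: complexI; rewrite rmorphM /= -!nrmE normrZ; congr (_ * _).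
Qed.

(* The library puts its topology on the alias R[i]^o of R[i]. *)
Lemma cvg_complex (u : (C^o)^nat) (a b : R) :
  (fun n => complex.Re (u n)) @ \oo --> a -> (fun n => complex.Im (u n)) @ \oo --> b ->
  u @ \oo --> (a +i* b : C^o).
Proof.
move=> ua ub; apply/cvgrPdist_le => e e0.
have [er e0'] : e = (complex.Re e)%:C /\ 0 < complex.Re e.
  have E : e = (complex.Re e)%:C.
    by rewrite [LHS]complexE (ger0_Im (ltW e0)) rmorph0 mulr0 addr0.
  by split => //; rewrite -ltcR -E.
have e2 : 0 < complex.Re e / 2 by rewrite divr_gt0.
have /cvgrPdist_le/(_ _ e2) ua' := ua.
have /cvgrPdist_le/(_ _ e2) ub' := ub.
near=> n.
rewrite [_ - u n]complexE (le_trans (ler_normD _ _))// er (splitr (complex.Re e)) rmorphD /=.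
rewrite lerD//.
  rewrite normc_def /= expr0n /= addr0 sqrtr_sqr lecR.
  have : `|a - complex.Re (u n)| <= complex.Re e / 2 by near: n.
  by case: (u n).
rewrite normrM [X in X * _]normc_def /= expr0n expr1n add0r sqrtr1 mul1r.
rewrite normc_def /= expr0n /= addr0 sqrtr_sqr lecR.
have : `|b - complex.Im (u n)| <= complex.Re e / 2 by near: n.
by case: (u n).
Unshelve. all: by end_near. Qed.

Lemma cvg_conjC (u : (C^o)^nat) (l : C^o) :
  u @ \oo --> l -> (fun n => Num.conj (u n) : C^o) @ \oo --> (Num.conj l : C^o).
Proof.
move=> /cvgrPdist_le ul; apply/cvgrPdist_le => e /ul.
by apply: filterS => n; rewrite -rmorphB /= norm_conjC.
Qed.

Lemma is_cvg_series_complex (u : (C^o)^nat) (M : R^nat) :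
  cvgn (series M) -> (forall k, `|u k| <= (M k)%:C) -> cvgn (series u).
Proof.
move=> cM uM.
have reim (g : C -> R) : additive g -> (forall z, `|g z|%:C <= `|z|) ->
    cvgn (fun n => g (series u n)).
  move=> ga gle.
  have -> : (fun n => g (series u n)) = series (fun k => g (u k)).
    apply/funext => n; rewrite /series /=; elim: n => [|n ih].
      by rewrite !big_geq//; have := ga 0 0; rewrite !subrr.
    rewrite !big_nat_recr//= -ih; set s := \sum_(_ <= _ < _) _.
    have g0 : g 0 = 0 by have := ga 0 0; rewrite !subrr.
    have gN z : g (- z) = - g z by have := ga 0 z; rewrite !sub0r g0 sub0r.
    by rewrite -[u n in LHS]opprK ga gN opprK.
  apply: normed_cvg; apply: (series_le_cvg _ _ _ cM) => k /=; first exact: normr_ge0.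
    by rewrite -ler0c; apply: le_trans (uM k).
  by rewrite -lecR; apply: le_trans (uM k); exact: gle.
have /cvg_ex[/= a ca] : cvgn (fun n => complex.Re (series u n)).
  by apply: reim => [x y|z]; [rewrite raddfB|exact: normc_ge_Re].
have /cvg_ex[/= b cb] : cvgn (fun n => complex.Im (series u n)).
  apply: reim => [x y|z]; first by rewrite raddfB.
  by case: z => x y; rewrite /= normc_def /= lecR -sqrtr_sqr ler_wsqrtr// lerDr sqr_ge0.
by apply/cvg_ex; exists (a +i* b); exact: cvg_complex.
Qed.

End Complex.

Section HilbertSum.
Variables (R : realType) (H : hilbert R).
Local Notation C := R[i].

Definition square_summable (x : nat -> H) : Prop :=
  cvgn (series (fun k => nrm (x k) ^+ 2)).

Lemma square_summableP (x : nat -> H) :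
  square_summable x <-> exists M, forall n, series (fun k => nrm (x k) ^+ 2) n <= M.
Proof.
have nd : nondecreasing_seq (series (fun k => nrm (x k) ^+ 2)).
  apply/nondecreasing_seqP => n.
  by rewrite /series /= big_nat_recr//= lerDl sqr_ge0.
split=> [cx|[M xM]].
  exists (limn (series (fun k => nrm (x k) ^+ 2))) => n.
  exact: (nondecreasing_cvgn_le nd cx n).
apply: nondecreasing_is_cvgn => //.
by exists M => _ [n _ <-].
Qed.

Definition l2pred : {pred nat -> H} := [pred x | `[< square_summable x >]].

Lemma square_summable_lin (a : C) (x y : nat -> H) :
  square_summable x -> square_summable y -> square_summable (a *: x + y).
Proof.
move=> /square_summableP[M xM] /square_summableP[N yN].
pose c := complex.Re `|a|.
apply/square_summableP; exists (2 * c ^+ 2 * M + 2 * N) => n.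
have c0 : 0 <= 2 * c ^+ 2 by rewrite mulr_ge0 ?sqr_ge0.
apply: (@le_trans _ _ (2 * c ^+ 2 * series (fun k => nrm (x k) ^+ 2) n
  + 2 * series (fun k => nrm (y k) ^+ 2) n)); last first.
  by rewrite lerD// ler_wpM2l.
rewrite /series /= !mulr_sumr -big_split /=; apply: ler_sum => k _.
have := nrmD (a *: x k) (y k); rewrite nrmZ -/c.
set p := nrm (x k); set q := nrm (y k) => le_pq.
have n0 : 0 <= nrm (a *: x k + y k) := nrm_ge0 _.
apply: (@le_trans _ _ ((c * p + q) ^+ 2)).
  by rewrite lerXn2r ?nnegrE ?(le_trans n0).
have := sqr_ge0 (c * p - q); rewrite sqrrB sqrrD exprMn; lra.
Qed.

Lemma l2pred_submod : submod_closed l2pred.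
Proof.
split=> [|a x y]; rewrite !inE.
  apply/square_summableP; exists 0 => n.
  by rewrite /series /= big1// => k _; rewrite /nrm normr0 expr0n.
exact: square_summable_lin.
Qed.
HB.instance Definition _ := GRing.isSubmodClosed.Build C (nat -> H) l2pred l2pred_submod.

Record hsum := HSum { hcoord :> nat -> H; hsum_subproof : hcoord \in l2pred }.
HB.instance Definition _ := [isSub for hcoord].
HB.instance Definition _ := [Choice of hsum by <:].
HB.instance Definition _ := [SubChoice_isSubLmodule of hsum by <:].

Lemma hsumP (x : hsum) : square_summable x.
Proof. by apply/asboolP; case: x. Qed.

Lemma hcoordD (x y : hsum) k : (x + y) k = x k + y k. Proof. by []. Qed.
Lemma hcoordZ a (x : hsum) k : (a *: x) k = a *: x k. Proof. by []. Qed.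

Definition hinner (x y : hsum) : C :=
  limn (series (fun k => inner H (x k) (y k) : C^o)).

Lemma inner_sqrt (x : H) : sqrtC (inner H x x) = `|x|.
Proof. by rewrite -hnormE sqrCK. Qed.

Lemma hinner_is_cvg (x y : hsum) :
  cvgn (series (fun k => inner H (x k) (y k) : C^o)).
Proof.
apply: (@is_cvg_series_complex _ _ (fun k => nrm (x k) ^+ 2 + nrm (y k) ^+ 2)).
  rewrite (_ : series _ = series (fun k => nrm (x k) ^+ 2) + series (fun k => nrm (y k) ^+ 2)).
    by apply: is_cvgD; exact: hsumP.
  by rewrite -seriesD.
move=> k.
have le1 : `|inner H (x k) (y k)| <= (nrm (x k) * nrm (y k))%:C.
  rewrite -(sqrCK (normr_ge0 (inner H _ _))) rmorphM /= -!nrmE -!inner_sqrt.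
  rewrite -sqrtCM ?nnegrE ?dnorm_ge0//.
  by rewrite ler_sqrtC ?nnegrE ?mulr_ge0 ?exprn_ge0 ?dnorm_ge0 ?dot_CauchySchwarz.
apply: le_trans le1 _; rewrite lecR.
set p := nrm (x k); set q := nrm (y k).
have p0 : 0 <= p := nrm_ge0 _.
have q0 : 0 <= q := nrm_ge0 _.
have := sqr_ge0 (p - q); have := mulr_ge0 p0 q0; rewrite sqrrB; lra.
Qed.

Lemma hinner_linearl (y : hsum) : linear_for *%R (hinner ^~ y).
Proof.
move=> a x x'; rewrite /hinner; apply/(@cvg_lim C^o); first exact: norm_hausdorff.
rewrite (_ : series _ = a *: series (fun k => inner H (x k) (y k) : C^o)
   + series (fun k => inner H (x' k) (y k) : C^o)).
  by apply: cvgD; [apply: cvgZr|]; apply: hinner_is_cvg.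
rewrite -seriesZ -seriesD; congr series; apply/funext => k /=.
by rewrite -[LHS]/(inner H (a *: x k + x' k) (y k)) linearDl /= linearZl_LR.
Qed.

Lemma hinnerC (x y : hsum) : hinner x y = Num.conj (hinner y x).
Proof.
rewrite /hinner; apply/(@cvg_lim C^o); first exact: norm_hausdorff.
rewrite (_ : series _ = (fun n => Num.conj (series (fun k => inner H (y k) (x k) : C^o) n) : C^o)).
  by apply: cvg_conjC; exact: hinner_is_cvg.
apply/funext => n; rewrite /series /= rmorph_sum /=; apply: eq_bigr => k _.
by rewrite hermC expr0 mul1r.
Qed.

Lemma hinner_linearr (x : hsum) : linear_for (Num.conj \; *%R) (hinner x).
Proof.
move=> a y y'; rewrite hinnerC hinner_linearl rmorphD rmorphM /=.
by rewrite -!hinnerC.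
Qed.

Lemma hinner_xx (x : hsum) :
  hinner x x = (limn (series (fun k => nrm (x k) ^+ 2)))%:C.
Proof.
rewrite /hinner; apply/(@cvg_lim C^o); first exact: norm_hausdorff.
have E n : series (fun k => inner H (x k) (x k) : C^o) n =
    (series (fun k => nrm (x k) ^+ 2) n)%:C.
  rewrite /series /= rmorph_sum; apply: eq_bigr => k _.
  by rewrite -hnormE nrmE rmorphXn.
apply: cvg_complex.
  rewrite (_ : (fun n => _) = series (fun k => nrm (x k) ^+ 2)); first exact: hsumP.
  by apply/funext => n; rewrite E.
rewrite (_ : (fun n => _) = (fun=> 0)); first exact: cvg_cst.
by apply/funext => n; rewrite E.
Qed.

Lemma hinner_ge_series (x : hsum) n :
  (series (fun k => nrm (x k) ^+ 2) n)%:C <= hinner x x.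
Proof.
rewrite hinner_xx lecR; apply: nondecreasing_cvgn_le; last exact: hsumP.
apply/nondecreasing_seqP => m.
by rewrite /series /= big_nat_recr//= lerDl sqr_ge0.
Qed.

Lemma hinner_ge_coord (x : hsum) k : `|x k| ^+ 2 <= hinner x x.
Proof.
apply: le_trans (hinner_ge_series x k.+1).
rewrite nrmE -rmorphXn lecR /series /= big_nat_recr//= lerDr.
by apply: sumr_ge0 => i _; exact: sqr_ge0.
Qed.

Lemma hinner_gt0 (x : hsum) : x != 0 -> 0 < hinner x x.
Proof.
move=> x0; have [k xk0] : exists k, x k != 0.
  apply/not_existsP => h; move/eqP: x0; apply; apply/val_inj/funext => k /=.
  by apply/eqP/negPn/negP; exact: h.
by apply: lt_le_trans (hinner_ge_coord x k); rewrite exprn_gt0 ?normr_gt0.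
Qed.

HB.instance Definition _ := @bilinear_isBilinear.Build C hsum hsum C *%R
  (Num.conj \; *%R) hinner (hinner_linearl, hinner_linearr).
Lemma hinner_herm (x y : hsum) :
  hinner x y = (-1) ^+ false * Num.conj (hinner y x).
Proof. by rewrite expr0 mul1r; exact: hinnerC. Qed.
HB.instance Definition _ := @isHermitianSesquilinear.Build C hsum false
  Num.conj hinner hinner_herm.
HB.instance Definition _ := @isDotProduct.Build C hsum hinner hinner_gt0.

Definition hnorm (x : hsum) : C := sqrtC (hinner x x).
Lemma hnormD x y : hnorm (x + y) <= hnorm x + hnorm y.
Proof. exact: dot_triangle. Qed.
Lemma hnormZ a x : hnorm (a *: x) = `|a| * hnorm x.
Proof. by rewrite /hnorm dnormZ sqrtCM ?nnegrE ?exprn_ge0 ?dnorm_ge0// sqrCK. Qed.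
Lemma hnorm0_eq0 x : hnorm x = 0 -> x = 0.
Proof. by move/eqP; rewrite sqrt_dnorm_eq0 => /eqP. Qed.
HB.instance Definition _ :=
  @Lmodule_isNormed.Build C hsum hnorm hnormD hnormZ hnorm0_eq0.

Lemma hsum_normE (x : hsum) : `|x| ^+ 2 = hinner x x.
Proof. exact: sqrtCK. Qed.

Lemma hsum_coord_le (x : hsum) k : `|x k| <= `|x|.
Proof.
rewrite -(@ler_pXn2r _ 2)// ?nnegrE//.
by rewrite hsum_normE hinner_ge_coord.
Qed.

Lemma hsum_series_le (x : hsum) n :
  series (fun k => nrm (x k) ^+ 2) n <= nrm x ^+ 2.
Proof.
by rewrite -lecR rmorphXn /= -nrmE hsum_normE hinner_ge_series.
Qed.

Lemma hsum_norm_le (x : hsum) (M : R) : 0 <= M ->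
  (forall n, series (fun k => nrm (x k) ^+ 2) n <= M ^+ 2) -> `|x| <= M%:C.
Proof.
move=> M0 xM; rewrite -(@ler_pXn2r _ 2)// ?nnegrE ?ler0c//.
rewrite hsum_normE hinner_xx -rmorphXn lecR.
by apply: limr_le; [exact: hsumP|exact: nearW].
Qed.

Lemma cvg_nrm (V : normedModType C) (T : Type) (F : set_system T)
    (FF : Filter F) (u : T -> V) (l : V) :
  u @ F --> l -> (fun t => nrm (u t)) @ F --> nrm l.
Proof.
move=> /cvgrPdist_le ul; apply/cvgrPdist_le => e e0.
have /ul : 0 < e%:C by rewrite -[0]/(0%:C) ltcR.
apply: filterS => t; rewrite nrmE lecR; apply: le_trans.
have h1 : nrm l <= nrm (l - u t) + nrm (u t) by rewrite -{1}[l](subrK (u t)) nrmD.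
have h2 : nrm (u t) <= nrm (l - u t) + nrm l.
  have -> : nrm (l - u t) = nrm (u t - l) by rewrite /nrm distrC.
  by rewrite -{1}[u t](subrK l) nrmD.
by rewrite ler_norml; apply/andP; split; lra.
Qed.

Lemma hsum_complete (F : set_system hsum) :
  ProperFilter F -> cauchy F -> cvg F.
Proof.
move=> FF Fc.
have Fce (e : R) : 0 < e -> exists A B : set hsum,
    [/\ F A, F B & forall y z, A y -> B z -> nrm (y - z) < e].
  move=> e0; have e0' : 0 < e%:C by rewrite -[0]/(0%:C) ltcR.
  have /cauchy_ballP/(_ _ e0')[[A B]/= [FA FB] AB] := Fc.
  exists A, B; split => // y z Ay Bz.
  by have := AB (y, z) (conj Ay Bz); rewrite -ball_normE /ball_ /= nrmE ltcR.
have coord k : cvg ((fun x : hsum => x k) @ F).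
  apply: cauchy_cvg; apply/cauchy_ballP => e e0.
  have [er er0] : e = (complex.Re e)%:C /\ 0 < complex.Re e.
    have E : e = (complex.Re e)%:C.
      by rewrite [LHS]complexE (ger0_Im (ltW e0)) rmorph0 mulr0 addr0.
    by split => //; rewrite -ltcR -E.
  have [A [B [FA FB AB]]] := Fce _ er0.
  exists ((fun x : hsum => x k) @` A, (fun x : hsum => x k) @` B).
    by split; [apply: (@filterS _ F _ A _ _ FA)|apply: (@filterS _ F _ B _ _ FB)] => x xA; exists x.
  move=> [_ _] /= [[y Ay <-] [z Bz <-]]; rewrite -ball_normE /ball_ /=.
  apply: le_lt_trans (hsum_coord_le (y - z) k) _.
  by rewrite er nrmE ltcR AB.
pose l k : H := lim ((fun x : hsum => x k) @ F).
have lP k : (fun x : hsum => x k) @ F --> l k := coord k.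
have key (e : R) : 0 < e -> F [set y : hsum | forall n,
    series (fun k => nrm (y k - l k) ^+ 2) n <= e ^+ 2].
  move=> e0; have [A [B [FA FB AB]]] := Fce _ e0.
  apply: filterS FA => y Ay n.
  have cv : (fun z : hsum => series (fun k => nrm (y k - z k) ^+ 2) n) @ F -->
      series (fun k => nrm (y k - l k) ^+ 2) n.
    rewrite /series /=; elim: n => [|n ih].
      by rewrite big_geq//; under eq_fun do rewrite big_geq//; exact: cvg_cst.
    rewrite big_nat_recr//=; under eq_fun do rewrite big_nat_recr//=.
    apply: cvgD => //; rewrite expr2; under eq_fun do rewrite expr2.
    have cn : (fun z : hsum => nrm (y n - z n)) @ F --> nrm (y n - l n).
      by apply: cvg_nrm; apply: cvgB; [exact: cvg_cst|exact: lP].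
    exact: cvgM.
  rewrite -(cvg_lim _ cv)//; apply: limr_le; first by apply/cvg_ex; eexists; exact: cv.
  apply: filterS FB => z Bz.
  apply: le_trans (hsum_series_le (y - z) n) _.
  by rewrite lerXn2r ?nnegrE ?nrm_ge0 ?(ltW e0)// ltW// AB.
have lss : square_summable l.
  have /filter_ex[y yl] := key 1 ltr01.
  have h : square_summable (fun k => y k - l k).
    by apply/square_summableP; exists (1 ^+ 2).
  rewrite (_ : l = (-1 : C) *: (fun k => y k - l k) + (y : nat -> H)).
    by apply: square_summable_lin => //; exact: hsumP.
  apply/funext => k; rewrite -[RHS]/(-1 *: (y k - l k) + y k).
  by rewrite scaleN1r opprB subrK.
have lp : l \in l2pred by rewrite inE.
apply/cvg_ex; exists (HSum lp); apply/cvgrPdist_le => e e0.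
have [er er0] : e = (complex.Re e)%:C /\ 0 < complex.Re e.
  have E : e = (complex.Re e)%:C.
    by rewrite [LHS]complexE (ger0_Im (ltW e0)) rmorph0 mulr0 addr0.
  by split => //; rewrite -ltcR -E.
apply: filterS (key _ er0) => y yl.
by rewrite distrC er; apply: (@hsum_norm_le (y - HSum lp) _ (ltW er0)); exact: yl.
Qed.

HB.instance Definition _ := Uniform_isComplete.Build hsum hsum_complete.

(* The orthogonal sum of countably many copies of H. *)
Definition hilbert_sum : hilbert R := @Hilbert R hsum hinner hsum_normE.

End HilbertSum.

Section HilbertSpaces.
Variables (R : realType) (H : hilbert R).
Local Notation C := R[i].

Definition separable : Prop := exists D : set H, countable D /\ dense D.

Definition finitely_spanned (S : set H) : Prop :=
  exists (n : nat) (v : 'I_n -> H), forall x, S x ->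
    exists c : 'I_n -> C, x = \sum_(i < n) c i *: v i.

Definition infinite_dimensional : Prop := ~ finitely_spanned [set: H].

Definition orthonormal_basis (E : set H) : Prop :=
  [/\ forall e, E e -> inner H e e = 1,
      forall e e', E e -> E e' -> e <> e' -> inner H e e' = 0 &
      forall x, (forall e, E e -> inner H x e = 0) -> x = 0].

(* A possibly unbounded operator is represented by its graph. *)
Definition op_graph (T : H -> H) : set (H * H) := [set p | p.2 = T p.1].

Definition op_domain (G : set (H * H)) : set H := [set x | exists y, G (x, y)].

Definition op_adjoint (G : set (H * H)) : set (H * H) :=
  [set p | forall q, G q -> inner H q.2 p.1 = inner H q.1 p.2].

(* Density of the domain makes the adjoint relation single-valued and linear,
   so the equality forces G to be the graph of a linear operator. *)
Definition self_adjoint (G : set (H * H)) : Prop :=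
  dense (op_domain G) /\ op_adjoint G = G.

Definition op_norm (G : set (H * H)) : \bar R :=
  ereal_sup [set (nrm p.2)%:E | p in [set p | G p /\ `|p.1| <= 1]].

Definition pure_point_spectrum (G : set (H * H)) : Prop :=
  exists E : set H, orthonormal_basis E /\
    forall e, E e -> exists l : C, G (e, l *: e).

Definition bounded_operator (T : H -> H) : Prop := linear T /\ continuous T.

Definition bounded_self_adjoint (T : H -> H) : Prop :=
  bounded_operator T /\ forall x y, inner H (T x) y = inner H x (T y).

Definition finite_rank_self_adjoint : set (H -> H) :=
  [set T | bounded_self_adjoint T /\ finitely_spanned (range T)].

Definition spectrum (A : H -> H) : set C :=
  [set l | ~ exists S : H -> H, [/\ bounded_operator S,
     forall x, S (A x - l *: x) = x & forall x, A (S x) - l *: S x = x]].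

Definition poly_op (p : {poly C}) (A : H -> H) : H -> H :=
  fun x => \sum_(i < size p) p`_i *: iter i A x.

(* T is the norm limit of p(A) as the polynomial p tends to f uniformly on the
   spectrum of A. *)
Definition is_functional_calculus (f : R -> C) (A T : H -> H) : Prop :=
  bounded_operator T /\
  forall e : R, 0 < e -> exists2 d : R, 0 < d &
    forall p : {poly C},
      (forall t : R, spectrum A t%:C -> `|p.[t%:C] - f t| <= d%:C) ->
      (op_norm (op_graph (poly_op p A - T)%R) <= e%:E)%E.

(* f(A); for bounded self-adjoint A and continuous f there is exactly one such
   operator, and the default value 0 is never used. *)
Definition functional_calculus (f : R -> C) (A : H -> H) : H -> H :=
  xget 0 [set T | is_functional_calculus f A T].

End HilbertSpaces.

Definition unitarily_equivalent (R : realType) (H K : hilbert R)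
    (G : set (H * H)) (G' : set (K * K)) : Prop :=
  exists U : H -> K,
    [/\ linear U, (forall x y, inner K (U x) (U y) = inner H x y),
        range U = [set: K] & forall x y, G (x, y) <-> G' (U x, U y)].

(* The supremum runs over operators on all complex Hilbert spaces. *)
Definition operator_modulus (R : realType) (f : R -> R[i]) (d : R) : \bar R :=
  ereal_sup [set e | exists (K : hilbert R) (A B : K -> K),
    [/\ bounded_self_adjoint A, bounded_self_adjoint B,
        (op_norm (op_graph (A - B)%R) <= d%:E)%E &
        e = op_norm (op_graph
              (functional_calculus f A - functional_calculus f B))]].

Section OrthogonalSums.
Variables (R : realType) (H : hilbert R).

(* The domain consists of the square-summable x with x k in the domain of G k
   and (G k (x k))_k square-summable. *)
Definition orthogonal_sum (G : nat -> set (H * H)) :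
    set (hilbert_sum H * hilbert_sum H) :=
  [set p | forall k, G k (hcoord p.1 k, hcoord p.2 k)].

End OrthogonalSums.

Definition double_orthogonal_sum (R : realType) (H : hilbert R)
    (T : nat -> nat -> H -> H) :
    set (hilbert_sum (hilbert_sum H) * hilbert_sum (hilbert_sum H)) :=
  orthogonal_sum (fun j => orthogonal_sum (fun k => op_graph (T j k))).

(* Main.v *)
(* Each member of K0 occurs infinitely often among the summands of every A_t:
   for t > 0 because infinitely many R_j lie within t of it.  Hence the A_t differ
   only by a permutation of the summands, and they inherit an orthonormal
   eigenbasis from the finite rank summands.

   The norm of f(A_t) - f(A_0) is the supremum of ||f(P) - f(Q)|| over P, Q in K0
   with ||P - Q|| < t, so it is at most Omega_f(t).  Conversely, let ||A - B|| <= t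
   on any Hilbert space and let x be a vector.  With p a polynomial uniformly close
   to f, the vectors p(A)x and p(B)x involve only finitely many iterates A^i x and
   B^i x.  Compressing A and B to the span of these iterates and moving the span
   isometrically into H gives finite rank operators on which p acts in the same
   way; shrinking them slightly makes their distance less than t, and then they can
   be replaced by members of K0.

   Polynomials control f(A) through ||p(A)|| <= sup |p| over the spectrum of A. *)
Require Import Defs.
From HB Require Import structures.
From mathcomp Require Import all_boot all_order all_algebra.
From mathcomp Require Import all_classical all_reals ereal topology normedtype.
From mathcomp Require Import sequences sesquilinear complex lra ring.
Import Order.TTheory GRing.Theory Num.Theory.
Import numFieldNormedType.Exports.
Set Implicit Arguments.
Unset Strict Implicit.
Unset Printing Implicit Defensive.
Local Open Scope classical_set_scope.
Local Open Scope complex_scope.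
Local Open Scope ring_scope.

(** * Linear maps, norms and inner products *)

(** Bounded operators are in general not norm limits of finite rank ones, which is why Omega_f(t) is
    bounded one vector x at a time. The compressions need not be close to A and B; they only have to
    reproduce p(A)x and p(B)x exactly, and they inherit the bounds on A, B and A - B. The polynomial
    p is fixed before compressing, so its Lipschitz constant on a ball of operators is at hand when
    members of [K0] replace the compressions. The shrinking is forced by the strict inequality that
    defines the summands of A_t against the non-strict one in Omega_f. The spectral bound is reached
    without spectral measures. Being bounded below takes the place of invertibility, and its failure
    passes from a polynomial in A to one of its linear factors. For the unitary equivalence, density
    alone gives one member of [K0] near a given one, whereas infinitely many indices j are required;
    a rank one perturbation supplies them. *)

Section LinearMaps.
Variables (A : pzRingType) (U V : lmodType A) (T : U -> V).
Hypothesis linT : linear T.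

Lemma linear_mapD x y : T (x + y) = T x + T y.
Proof. by have := linT 1 x y; rewrite !scale1r. Qed.

Lemma linear_map0 : T 0 = 0.
Proof. by apply: (addrI (T 0)); rewrite -linear_mapD !addr0. Qed.

Lemma linear_mapZ a x : T (a *: x) = a *: T x.
Proof. by have := linT a x 0; rewrite !addr0 linear_map0 addr0. Qed.

Lemma linear_mapN x : T (- x) = - T x.
Proof. by rewrite -!scaleN1r linear_mapZ. Qed.

Lemma linear_mapB x y : T (x - y) = T x - T y.
Proof. by rewrite linear_mapD linear_mapN. Qed.

Lemma linear_map_sum I (r : seq I) (P : pred I) (F : I -> U) :
  T (\sum_(i <- r | P i) F i) = \sum_(i <- r | P i) T (F i).
Proof.
by apply: (big_morph T); [exact: linear_mapD|exact: linear_map0].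
Qed.
End LinearMaps.

Section RealNorm.
Variable R : realType.
Local Notation C := R[i].

Lemma le_of_eps (a b c : R) : 0 <= c ->
  (forall e, 0 < e -> a <= b + e * c) -> a <= b.
Proof.
move=> c0 h; apply/ler_addgt0Pr => e e0.
have c1 : 0 < c + 1 by rewrite ltr_wpDl.
apply: le_trans (h (e / (c + 1)) _) _; first by rewrite divr_gt0.
by rewrite lerD2l mulrAC ler_pdivrMr// ler_wpM2l ?(ltW e0)// lerDl.
Qed.

Lemma Re_normC (z : C) : (complex.Re `|z|)%:C = `|z|.
Proof. by rewrite [RHS]complexE (ger0_Im (normr_ge0 z)) rmorph0 mulr0 addr0. Qed.

Lemma Re_norm_real (r : R) : complex.Re `|r%:C| = `|r|.
Proof. by rewrite normc_def /= expr0n addr0 sqrtr_sqr. Qed.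

Lemma Re_norm_ge0 (z : C) : 0 <= complex.Re `|z|.
Proof. by rewrite -ler0c Re_normC. Qed.

Variable V : normedModType C.
Implicit Types x y z : V.

Lemma nrm0 : nrm (0 : V) = 0.
Proof. by rewrite /nrm normr0. Qed.

Lemma nrm_eq0 x : nrm x = 0 -> x = 0.
Proof. by move=> h; apply/eqP; rewrite -normr_eq0 nrmE h. Qed.

Lemma nrm_gt0 x : x != 0 -> 0 < nrm x.
Proof.
move=> x0; rewrite lt_neqAle nrm_ge0 andbT eq_sym.
by apply: contra_neq x0; exact: nrm_eq0.
Qed.

Lemma nrmN x : nrm (- x) = nrm x.
Proof. by rewrite /nrm normrN. Qed.

Lemma nrm_dist x y : nrm (x - y) = nrm (y - x).
Proof. by rewrite -nrmN opprB. Qed.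

Lemma nrm_distD z x y : nrm (x - y) <= nrm (x - z) + nrm (z - y).
Proof. by rewrite (le_trans _ (nrmD _ _))// addrA subrK. Qed.

Lemma nrmB x y : nrm (x - y) <= nrm x + nrm y.
Proof. by rewrite -(nrmN y) nrmD. Qed.

Lemma nrmZr (r : R) x : nrm (r%:C *: x) = `|r| * nrm x.
Proof. by rewrite nrmZ Re_norm_real. Qed.

Lemma eq_of_nrm x y : (forall e, 0 < e -> nrm (x - y) <= e) -> x = y.
Proof.
move=> h; apply/eqP; rewrite -subr_eq0; apply/eqP/nrm_eq0/eqP.
rewrite eq_le nrm_ge0 andbT; apply/ler_addgt0Pr => e e0.
by rewrite add0r; exact: h.
Qed.

Lemma cvg_nrm_le (u : nat -> V) (l x : V) (M : R) (N : nat) :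
  u @ \oo --> l -> (forall n, (N <= n)%N -> nrm (x - u n) <= M) -> nrm (x - l) <= M.
Proof.
move=> ul h.
have cv : (fun n => nrm (x - u n)) @ \oo --> nrm (x - l).
  by apply: cvg_nrm; apply: cvgB => //; exact: cvg_cst.
rewrite -(cvg_lim _ cv)//; apply: limr_le.
  by apply/cvg_ex; eexists; exact: cv.
by exists N => // n /= ?; exact: h.
Qed.
End RealNorm.

Lemma cauchy_nrm_cvg (R : realType) (V : completeNormedModType R[i]) (u : nat -> V) :
  (forall e : R, 0 < e -> exists N, forall m n, (N <= m)%N -> (N <= n)%N ->
     nrm (u m - u n) <= e) -> cvgn u.
Proof.
move=> h; apply: cauchy_cvg; apply/cauchy_ballP => e e0.
have eE : e = (complex.Re e)%:C.
  by rewrite [LHS]complexE (ger0_Im (ltW e0)) rmorph0 mulr0 addr0.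
have er0 : 0 < complex.Re e by rewrite -ltcR -eE.
have [|N hN] := h (complex.Re e / 2); first by rewrite divr_gt0.
exists (u @` [set n | (N <= n)%N], u @` [set n | (N <= n)%N]).
  by split; exists N => // n /= ?; exists n.
move=> [_ _] /= [[m Nm <-] [n Nn <-]]; rewrite -ball_normE /ball_ /= nrmE eE ltcR.
by apply: le_lt_trans (hN _ _ Nm Nn) _; rewrite ltr_pdivrMr// ltr_pMr// ltr1n.
Qed.

Section InnerProduct.
Variables (R : realType) (K : hilbert R).
Local Notation C := R[i].
Implicit Types x y z : K.

Lemma innerDl x y z : inner K (x + y) z = inner K x z + inner K y z.
Proof. by rewrite linearDl. Qed.

Lemma innerDr x y z : inner K x (y + z) = inner K x y + inner K x z.
Proof. by rewrite linearDr. Qed.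

Lemma innerZl (a : C) x y : inner K (a *: x) y = a * inner K x y.
Proof. by rewrite linearZl_LR. Qed.

Lemma innerZr (a : C) x y : inner K x (a *: y) = Num.conj a * inner K x y.
Proof. by rewrite linearZr_LR. Qed.

Lemma innerC x y : inner K x y = Num.conj (inner K y x).
Proof. by rewrite hermC expr0 mul1r. Qed.

Lemma inner0l x : inner K 0 x = 0.
Proof. by rewrite linear0l. Qed.

Lemma inner0r x : inner K x 0 = 0.
Proof. by rewrite linear0r. Qed.

Lemma innerNl x y : inner K (- x) y = - inner K x y.
Proof. by rewrite linearNl. Qed.

Lemma innerNr x y : inner K x (- y) = - inner K x y.
Proof. by rewrite linearNr. Qed.

Lemma innerBl x y z : inner K (x - y) z = inner K x z - inner K y z.
Proof. by rewrite innerDl innerNl. Qed.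

Lemma innerBr x y z : inner K x (y - z) = inner K x y - inner K x z.
Proof. by rewrite innerDr innerNr. Qed.

Lemma inner_self x : inner K x x = (nrm x ^+ 2)%:C.
Proof. by rewrite -hnormE nrmE rmorphXn. Qed.

Lemma inner_norm_le x y : `|inner K x y| <= (nrm x * nrm y)%:C.
Proof.
rewrite -(@ler_pXn2r _ 2)// ?nnegrE ?normr_ge0 ?ler0c ?mulr_ge0 ?nrm_ge0//.
by rewrite (le_trans (dot_CauchySchwarz _ _ _))// !inner_self -rmorphM -rmorphXn exprMn.
Qed.

Lemma Re_inner_le x y : complex.Re (inner K x y) <= nrm x * nrm y.
Proof.
rewrite -lecR; apply: le_trans (inner_norm_le x y).
by apply: le_trans (normc_ge_Re _); rewrite lecR ler_norm.
Qed.

Lemma inner_eq0 x : inner K x x = 0 -> x = 0.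
Proof.
rewrite inner_self => /complexI/eqP; rewrite sqrf_eq0 => /eqP; exact: nrm_eq0.
Qed.

Lemma inner_inj x y : (forall z, inner K z x = inner K z y) -> x = y.
Proof.
move=> h; apply/eqP; rewrite -subr_eq0; apply/eqP/inner_eq0.
by rewrite innerBr h subrr.
Qed.

Lemma inner_injl x y : (forall z, inner K x z = inner K y z) -> x = y.
Proof. by move=> h; apply: inner_inj => z; rewrite innerC h -innerC. Qed.

Lemma nrm_sqrB x y :
  nrm (x - y) ^+ 2 = nrm x ^+ 2 - 2 * complex.Re (inner K x y) + nrm y ^+ 2.
Proof.
apply: complexI; rewrite -inner_self innerBl !innerBr !inner_self (innerC y x).
case: (inner K x y) => a b; rewrite !opprD; simpc; rewrite addNr /=; congr (_ +i* _); ring.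
Qed.

Lemma exists_unit x : x != 0 -> exists2 a : C, a != 0 & inner K (a *: x) (a *: x) = 1.
Proof.
move=> /nrm_gt0 x0; have xn0 : nrm x != 0 by rewrite gt_eqF.
exists ((nrm x)^-1)%:C.
  by apply/eqP => /complexI/eqP; rewrite invr_eq0; exact/negP.
by rewrite inner_self nrmZr ger0_norm ?invr_ge0 ?nrm_ge0// mulVf// expr1n.
Qed.
End InnerProduct.

(** * Operator norms and polynomials in an operator *)

Section OperatorNorm.
Variables (R : realType) (H : hilbert R).
Local Notation C := R[i].

(** Stated for graphs because an orthogonal sum of bounded operators may be unbounded and is then
    not given by a total function. *)
Definition relation_bound (G : set (H * H)) (M : R) : Prop :=
  forall x y, G (x, y) -> nrm y <= M * nrm x.

Definition operator_bound (T : H -> H) (M : R) : Prop :=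
  forall x, nrm (T x) <= M * nrm x.

Definition homogeneous (G : set (H * H)) : Prop :=
  forall (a : C) x y, G (x, y) -> G (a *: x, a *: y).

Lemma op_norm_leP (G : set (H * H)) (M : R) : homogeneous G -> 0 <= M ->
  (op_norm G <= M%:E)%E <-> relation_bound G M.
Proof.
move=> hG M0; split=> [le_GM x y Gxy|hM].
  apply: (le_of_eps M0) => e e0; rewrite (mulrC e) -mulrDr.
  (* Dividing by [nrm x + e] rather than by [nrm x] covers x = 0 too, where the bound has to force y
     = 0; e then tends to 0. *)
  have s0 : 0 < nrm x + e by rewrite ltr_wpDl ?nrm_ge0.
  have : ((nrm (((nrm x + e)^-1)%:C *: y))%:E <= M%:E)%E.
    apply: le_trans le_GM; apply: ereal_sup_ubound.
    exists (((nrm x + e)^-1)%:C *: x, ((nrm x + e)^-1)%:C *: y) => //=; split.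
      exact: hG.
    rewrite nrmE nrmZr ger0_norm ?invr_ge0 ?(ltW s0)// -[1]/(1%:C) lecR.
    by rewrite mulrC ler_pdivrMr// mul1r lerDl ltW.
  rewrite lee_fin nrmZr ger0_norm ?invr_ge0 ?(ltW s0)//.
  by rewrite mulrC ler_pdivrMr.
apply: ge_ereal_sup => _ [[x y] /= [Gxy x1] <-].
rewrite lee_fin (le_trans (hM _ _ Gxy))// ler_piMr//.
by move: x1; rewrite nrmE -[1]/(1%:C) lecR.
Qed.

Lemma op_graph_homogeneous (T : H -> H) : linear T -> homogeneous (op_graph T).
Proof. by move=> lT a x y; rewrite /op_graph /= => ->; rewrite linear_mapZ. Qed.

Lemma operator_norm_leP (T : H -> H) (M : R) : linear T -> 0 <= M ->
  (op_norm (op_graph T) <= M%:E)%E <-> operator_bound T M.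
Proof.
move=> lT M0; rewrite op_norm_leP//; last exact: op_graph_homogeneous.
by split=> [h x|h x y]; [exact: h|rewrite /op_graph /= => ->; exact: h].
Qed.

Lemma op_norm_ge0 (G : set (H * H)) : G (0, 0) -> (0 <= op_norm G)%E.
Proof.
move=> G0; apply: ereal_sup_ubound; exists (0, 0) => /=; last by rewrite nrm0.
by split=> //; rewrite normr0.
Qed.

(** The norm itself, finite because it lies below M, serves as the witness m. *)
Lemma operator_norm_ltP (T : H -> H) (M : R) : linear T ->
  (op_norm (op_graph T) < M%:E)%E <->
  exists2 m : R, 0 <= m < M & operator_bound T m.
Proof.
move=> lT; split=> [ltM|[m /andP[m0 mM] hm]].
  have ge0 : (0 <= op_norm (op_graph T))%E.
    by apply: op_norm_ge0; rewrite /op_graph /= linear_map0.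
  have fin : op_norm (op_graph T) \is a fin_num.
    by rewrite ge0_fin_numE// (lt_trans ltM)// ltry.
  exists (fine (op_norm (op_graph T))).
    by rewrite fine_ge0//= -lte_fin fineK.
  apply/operator_norm_leP => //; first exact: fine_ge0.
  by rewrite fineK.
by apply: (@le_lt_trans _ _ m%:E); [exact/operator_norm_leP|rewrite lte_fin].
Qed.
End OperatorNorm.

Lemma fun_subE (T : Type) (V : zmodType) (A B : T -> V) (x : T) : (A - B)%R x = A x - B x.
Proof. by []. Qed.

Section PolynomialsInOperators.
Variables (R : realType) (H : hilbert R).
Local Notation C := R[i].
Implicit Types (p q : {poly C}) (A B : H -> H).

Lemma poly_op_widen n p A x : (size p <= n)%N ->
  poly_op p A x = \sum_(i < n) p`_i *: iter i A x.
Proof.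
move=> pn; rewrite /poly_op -(subnKC pn) big_split_ord /= [X in _ + X]big1 ?addr0// => i _.
by rewrite nth_default ?scale0r// leq_addr.
Qed.

Lemma poly_op0 A x : poly_op 0 A x = 0.
Proof. by rewrite /poly_op size_poly0 big_ord0. Qed.

Lemma poly_opC c A x : poly_op c%:P A x = c *: x.
Proof.
by rewrite (@poly_op_widen 1) ?size_polyC_leq1// big_ord1 coefC.
Qed.

Lemma poly_opD p q A x : poly_op (p + q) A x = poly_op p A x + poly_op q A x.
Proof.
have le_n := size_polyD p q; set n := maxn _ _ in le_n.
rewrite (poly_op_widen _ _ le_n) (@poly_op_widen n p) ?leq_maxl//.
rewrite (@poly_op_widen n q) ?leq_maxr// -big_split /=.
by apply: eq_bigr => i _; rewrite coefD scalerDl.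
Qed.

Lemma poly_opMX p A x : poly_op (p * 'X) A x = poly_op p A (A x).
Proof.
rewrite (@poly_op_widen (size p).+1); last first.
  by rewrite (leq_trans (size_polyMleq _ _))// size_polyX addn2.
rewrite big_ord_recl coefMX eqxx scale0r add0r /poly_op.
by apply: eq_bigr => i _; rewrite coefMX /= -iterS iterSr.
Qed.

Lemma poly_op_cons p c A x :
  poly_op (p * 'X + c%:P) A x = poly_op p A (A x) + c *: x.
Proof. by rewrite poly_opD poly_opMX poly_opC. Qed.

Lemma poly_op_linear p A : linear A -> linear (poly_op p A).
Proof.
move=> lA; elim/poly_ind: p => [|p c ih] a x y.
  by rewrite !poly_op0 scaler0 addr0.
by rewrite !poly_op_cons lA ih !scalerDr !scalerA (mulrC c) addrACA.
Qed.

Lemma poly_opZ c p A x : linear A -> poly_op (c *: p) A x = c *: poly_op p A x.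
Proof.
move=> lA; elim/poly_ind: p x => [|p d ih] x; first by rewrite scaler0 !poly_op0 scaler0.
by rewrite scalerDr scalerAl -[c *: d%:P]mul_polyC -polyCM !poly_op_cons ih scalerDr scalerA.
Qed.

Lemma poly_opB p q A x : linear A ->
  poly_op (p - q) A x = poly_op p A x - poly_op q A x.
Proof. by move=> lA; rewrite poly_opD -scaleN1r poly_opZ// scaleN1r. Qed.

Lemma poly_op_comm p A x : linear A -> poly_op p A (A x) = A (poly_op p A x).
Proof.
move=> lA; elim/poly_ind: p x => [|p c ih] x; first by rewrite !poly_op0 (linear_map0 lA).
by rewrite !poly_op_cons (linear_mapD lA) (linear_mapZ lA) !ih.
Qed.

Lemma poly_opM p q A x : linear A ->
  poly_op (p * q) A x = poly_op p A (poly_op q A x).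
Proof.
move=> lA; elim/poly_ind: p x => [|p c ih] x; first by rewrite mul0r !poly_op0.
rewrite mulrDl poly_opD -mulrA ['X * q]mulrC mulrA poly_opMX ih poly_op_comm//.
by rewrite mul_polyC poly_opZ// poly_op_cons.
Qed.

(** Intertwining is asked only along the orbit of x and only for as many steps as the degree of p,
    which is all that a compression can offer. *)
Lemma poly_op_intertwine (K : hilbert R) (W : K -> H) p A (B : K -> K) x :
  linear W -> (forall i, (i < (size p).-1)%N -> A (W (iter i B x)) = W (iter i.+1 B x)) ->
  poly_op p A (W x) = W (poly_op p B x).
Proof.
move=> lW h; rewrite /poly_op linear_map_sum//; apply: eq_bigr => i _.
rewrite linear_mapZ//; congr (_ *: _).
have : (i <= (size p).-1)%N by rewrite -ltnS prednK ?ltn_ord// (leq_trans _ (ltn_ord i)).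
by elim: (nat_of_ord i) => //= k ih kp; rewrite ih ?(ltnW kp)// h.
Qed.

Lemma poly_op_bound p (M : R) : 0 <= M -> exists2 N : R, 0 <= N &
  forall A, operator_bound A M -> operator_bound (poly_op p A) N.
Proof.
move=> M0; elim/poly_ind: p => [|p c [N N0 ih]].
  by exists 0 => // A _ x; rewrite poly_op0 nrm0 mul0r.
exists (N * M + complex.Re `|c|); first by rewrite addr_ge0 ?mulr_ge0 ?Re_norm_ge0.
move=> A AM x; rewrite poly_op_cons (le_trans (nrmD _ _))// nrmZ mulrDl lerD2r.
by rewrite (le_trans (ih _ AM _))// -mulrA ler_wpM2l// AM.
Qed.

(** The induction rests on p(A)A - p(B)B = (p(A) - p(B))A + p(B)(A - B). L depends only on p and M,
    so it can be fixed before the operators are chosen. *)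
Lemma poly_op_lipschitz p (M : R) : 0 <= M -> exists2 L : R, 0 <= L &
  forall A B d, linear A -> linear B -> operator_bound A M -> operator_bound B M ->
    operator_bound (A - B)%R d -> 0 <= d ->
    operator_bound (poly_op p A - poly_op p B)%R (L * d).
Proof.
move=> M0; elim/poly_ind: p => [|p c [L L0 ih]].
  exists 0 => // A B d _ _ _ _ _ _ x.
  by rewrite fun_subE !poly_op0 subrr nrm0 !mul0r.
have [N N0 hN] := poly_op_bound p M0.
exists (L * M + N); first by rewrite addr_ge0// mulr_ge0.
move=> A B d lA lB AM BM ABd d0 x.
rewrite fun_subE !poly_op_cons opprD addrACA subrr addr0.
have -> : poly_op p A (A x) - poly_op p B (B x) =
    (poly_op p A - poly_op p B) (A x) + poly_op p B ((A - B) x).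
  by rewrite !fun_subE (linear_mapB (poly_op_linear p lB)) addrA subrK.
rewrite (le_trans (nrmD _ _))// 2!mulrDl lerD//.
  rewrite (le_trans (ih _ _ _ lA lB AM BM ABd d0 _))//.
  by rewrite (mulrAC L M) -(mulrA (L * d)) ler_wpM2l ?mulr_ge0// AM.
by rewrite (le_trans (hN _ BM _))// -mulrA ler_wpM2l// ABd.
Qed.

Lemma poly_op_adjoint p A (x y : H) : linear A ->
  (forall x y, inner H (A x) y = inner H x (A y)) ->
  inner H (poly_op p A x) y = inner H x (poly_op (map_poly Num.conj p) A y).
Proof.
move=> lA sA; elim/poly_ind: p x y => [|p c ih] x y.
  by rewrite rmorph0 !poly_op0 inner0l inner0r.
rewrite rmorphD rmorphM /= map_polyX map_polyC /= !poly_op_cons innerDl innerDr innerZl innerZr.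
rewrite conjCK ih sA; by rewrite -poly_op_comm.
Qed.
End PolynomialsInOperators.

(** * Weierstrass approximation *)

Section Weierstrass.
Variable R : realType.
Local Notation C := R[i].

(* Uniform continuity on [-M, M], in the form that a second moment can use. *)
Lemma quadratic_modulus (f : R -> C^o) (M e : R) : continuous f -> 0 < e ->
  exists2 c : R, 0 <= c & forall s t, -M <= s <= M -> -M <= t <= M ->
    nrm (f t - f s) <= e + c * (t - s) ^+ 2.
Proof.
move=> cf e0.
have near_f s0 d : 0 < d -> \forall s \near s0, nrm (f s - f s0) <= d.
  move=> d0; have d0' : 0 < d%:C by rewrite -[0]/(0%:C) ltcR.
  have /cvgrPdist_le/(_ _ d0') := cf s0; apply: filterS => s.
  by rewrite nrmE lecR nrm_dist.
have /compact_near_coveringP near_cov := @segment_compact R (-M) M.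
have inE s : -M <= s <= M -> `[-M, M]%classic s by rewrite /= in_itv.
have [B hB] : exists B, forall s, -M <= s <= M -> nrm (f s) <= B.
  have [N [_ hN]] : \forall B \near +oo, `[-M, M]%classic `<=` (fun s => nrm (f s) <= B).
    apply: near_cov => s0 _.
    near=> s B => /=.
    have h : nrm (f s - f s0) <= 1 by near: s; apply: near_f; exact: ltr01.
    have hB : nrm (f s0) + 1 <= B by near: B; apply: nbhs_pinfty_ge; exact: num_real.
    have := nrmD (f s - f s0) (f s0); rewrite subrK; lra.
  by exists (N + 1) => s /inE sM; apply: hN sM; rewrite ltrDl.
have [N [_ hN]] : \forall c \near +oo, `[-M, M]%classic `<=`
    (fun s => -M <= s <= M -> forall t, -M <= t <= M ->
      nrm (f t - f s) <= e + c * (t - s) ^+ 2).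
  apply: near_cov => s0 _.
  have [d d0 hd] : exists2 d, 0 < d & forall s, `|s - s0| < d -> nrm (f s - f s0) <= e / 2.
    have e2 : 0 < e / 2 by rewrite divr_gt0.
    have /nbhs_ballP[d /= d0 hd] := near_f s0 _ e2.
    by exists d => // s sd; apply: hd; rewrite -ball_normE /ball_ /= distrC.
  near=> s c => /= sM t tM.
  have ss0 : `|s - s0| < d / 2.
    by near: s; apply: cvgr_distC_lt => //; rewrite divr_gt0.
  (* This c serves the t at distance at least d / 2 from s: there c (t - s)^2 >= 2 B, which
     dominates |f(t) - f(s)|. *)
  have cB : 8 * B / d ^+ 2 <= c by near: c; apply: nbhs_pinfty_ge; exact: num_real.
  have c0 : 0 <= c by near: c; apply: nbhs_pinfty_ge; exact: num_real.
  have [td|td] := ltP `|t - s0| d.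
    have sd : `|s - s0| < d by rewrite (lt_trans ss0)// gtr_pMr// invf_lt1// ltr1n.
    have := nrm_distD (f s0) (f t) (f s); rewrite (nrm_dist (f s0)).
    have := hd _ td; have := hd _ sd; have := mulr_ge0 c0 (sqr_ge0 (t - s)); lra.
  have ts : d / 2 <= `|t - s|.
    have := ler_normD (t - s) (s - s0); rewrite addrA subrK; lra.
  have := nrmB (f t) (f s); have := hB _ tM; have := hB _ sM.
  have : 2 * B <= c * (t - s) ^+ 2.
    rewrite -(real_normK (num_real (t - s))).
    move: cB; rewrite ler_pdivrMr ?exprn_gt0// => cB.
    have h : (d / 2) ^+ 2 <= `|t - s| ^+ 2 by rewrite lerXn2r ?nnegrE ?divr_ge0 ?(ltW d0).
    have := ler_wpM2l c0 h; rewrite expr_div_n; lra.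
  lra.
exists (Num.max 0 (N + 1)); first by rewrite le_max lexx.
move=> s t sM tM; have := hN (Num.max 0 (N + 1)) _ s (inE _ sM) sM t tM; apply.
by rewrite lt_max ltrDl ltr01 orbT.
Unshelve. all: by end_near. Qed.

(* The Bernstein operator as an expectation over n coin tosses, conditioned on
   the first one; q is an affine change of variable. *)
Fixpoint bernstein (q : {poly C}) (n : nat) (g : nat -> C) : {poly C} :=
  if n is m.+1 then q * bernstein q m (g \o S) + (1 - q) * bernstein q m g
  else (g 0%N)%:P.

Fixpoint bernstein_mean (x : R) (n : nat) (h : nat -> R) : R :=
  if n is m.+1 then x * bernstein_mean x m (h \o S) + (1 - x) * bernstein_mean x m h
  else h 0%N.

(** For the number k of successes in n trials, the mean of (k - a)^2 is the variance n x (1 - x)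
    plus the squared bias. The centre a is arbitrary because a first success shifts it to a - 1. *)
Lemma bernstein_mean_quadratic x n e c a :
  bernstein_mean x n (fun k => e + c * (k%:R - a) ^+ 2) =
  e + c * (n%:R * x * (1 - x) + (n%:R * x - a) ^+ 2).
Proof.
elim: n a => [|n ih] a /=; first by ring.
rewrite (_ : _ \o S = fun k => e + c * (k%:R - (a - 1)) ^+ 2); last first.
  by apply/funext => k /=; rewrite -natr1; ring.
by rewrite !ih -natr1; ring.
Qed.

(** As q(z) = x lies in [0, 1], each step of the recursion is a convex combination, so the distances
    to w average just like their bounds h. *)
Lemma bernstein_dist (q : {poly C}) n (g : nat -> C) (h : nat -> R) (z w : C) (x : R) :
  0 <= x <= 1 -> q.[z] = x%:C ->
  (forall k, (k <= n)%N -> nrm (g k - w : C^o) <= h k) ->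
  nrm ((bernstein q n g).[z] - w : C^o) <= bernstein_mean x n h.
Proof.
move=> /andP[x0 x1] qz; elim: n g h => [|n ih] g h gh /=; first by rewrite hornerC gh.
rewrite !hornerE qz.
set u := (bernstein q n (g \o S)).[z]; set v := (bernstein q n g).[z].
have -> : x%:C * u + (1 - x%:C) * v - w = x%:C *: (u - w : C^o) + (1 - x)%:C *: (v - w : C^o).
  by rewrite /GRing.scale /= rmorphB /=; ring.
rewrite (le_trans (nrmD _ _))// !nrmZr ger0_norm// ger0_norm ?subr_ge0//.
rewrite lerD// ler_wpM2l ?subr_ge0//; first by apply: ih => k kn; exact: gh.
by apply: ih => k kn; apply: gh; exact: leqW.
Qed.

Lemma weierstrass (f : R -> C^o) (M e : R) : continuous f -> 0 < e ->
  exists p : {poly C}, forall t, -M <= t <= M -> nrm (p.[t%:C] - f t : C^o) <= e.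
Proof.
move=> cf e0; wlog M0 : M / 0 < M.
  move=> wl; have [p hp] := wl (Num.max M 1) ltac:(by rewrite lt_max ltr01 orbT).
  exists p => t /andP[t1 t2]; apply: hp; rewrite (le_trans _ t1) ?lerN2 ?le_max ?lexx//=.
  by rewrite t2.
have [c c0 hc] := @quadratic_modulus f M (e / 2) cf ltac:(by rewrite divr_gt0).
(* With n + 1 tosses the variance term c (2 M)^2 x (1 - x) / (n + 1) is at most e / 2; the other e /
   2 is the constant term of [quadratic_modulus]. *)
have [n hn] : exists n : nat, c * (2 * M) ^+ 2 / (e / 2) < n.+1%:R.
  exists (Num.truncn (c * (2 * M) ^+ 2 / (e / 2))).
  by exact: truncnS_gt.
(* q maps [-M, M] affinely onto [0, 1], and [t_ k] is the node that it sends to k / (n + 1). *)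
pose q : {poly C} := ((2 * M)^-1)%:C *: 'X + (2^-1)%:C%:P.
pose t_ k : R := 2 * M * (k%:R / n.+1%:R) - M.
exists (bernstein q n.+1 (f \o t_)) => t tM; pose x := (2 * M)^-1 * t + 2^-1.
have n0 : 0 < n.+1%:R :> R by rewrite ltr0n.
have nn0 : n.+1%:R != 0 :> R by rewrite gt_eqF.
have M2 : 0 < 2 * M by rewrite mulr_gt0.
have tE : t = 2 * M * x - M by rewrite /x; field; rewrite gt_eqF.
have x01 : 0 <= x <= 1.
  move: tM; rewrite tE => /andP[h1 h2]; apply/andP; split.
    by rewrite -(pmulr_rge0 _ M2); lra.
  by rewrite -(ler_pM2l M2); lra.
have qt : q.[t%:C] = x%:C by rewrite /q !hornerE rmorphD rmorphM.
apply: le_trans (@bernstein_dist q n.+1 _ (fun k => e / 2 +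
  (c * (2 * M) ^+ 2 / n.+1%:R ^+ 2) * (k%:R - n.+1%:R * x) ^+ 2) t%:C (f t) x x01 qt _) _.
  move=> k kn /=; rewrite (le_trans (hc _ _ tM _))//.
    have kn1 : k%:R <= n.+1%:R :> R by rewrite ler_nat.
    have k0 : 0 <= k%:R / n.+1%:R :> R by rewrite divr_ge0.
    have k1 : k%:R / n.+1%:R <= 1 :> R by rewrite ler_pdivrMr// mul1r.
    have := mulr_ge0 (ltW M2) k0; have := ler_wpM2l (ltW M2) k1.
    rewrite /t_; set r := 2 * M * _.
    by move=> h1 h2; apply/andP; split; lra.
  by rewrite lerD2l le_eqVlt; apply/orP; left; apply/eqP; rewrite /t_ tE; field.
rewrite bernstein_mean_quadratic subrr expr0n /= addr0.
have -> : c * (2 * M) ^+ 2 / n.+1%:R ^+ 2 * (n.+1%:R * x * (1 - x)) =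
   c * (2 * M) ^+ 2 / n.+1%:R * (x * (1 - x)) by field.
have cn : c * (2 * M) ^+ 2 / n.+1%:R <= e / 2.
  move: hn; rewrite ltr_pdivrMr ?divr_gt0// => /ltW hn.
  by rewrite ler_pdivrMr// (mulrC (e / 2)).
have cn0 : 0 <= c * (2 * M) ^+ 2 / n.+1%:R by rewrite divr_ge0// mulr_ge0// sqr_ge0.
have x2 : x * (1 - x) <= 1 by move: x01 => /andP[? ?]; nra.
have := ler_wpM2l cn0 x2; move: cn; set k := _ / _ => cn.
set u := x * _; lra.
Qed.
End Weierstrass.

(** * The spectrum of a self-adjoint operator *)

Section BoundedOperators.
Variables (R : realType) (H : hilbert R).
Local Notation C := R[i].
Implicit Types (T A S : H -> H).

Lemma linear_continuous_bound T : linear T -> continuous T ->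
  exists2 M : R, 0 < M & operator_bound T M.
Proof.
move=> lT cT.
have /cvgrPdist_le/(_ _ (@ltr01 C)) := cT 0.
rewrite (linear_map0 lT) => /nbhs_ballP[d /= d0 hd].
have dE : d = (complex.Re d)%:C.
  by rewrite [LHS]complexE (ger0_Im (ltW d0)) rmorph0 mulr0 addr0.
have r0 : 0 < complex.Re d by rewrite -ltcR -dE.
pose r := complex.Re d / 2; have rp : 0 < r by rewrite divr_gt0.
exists r^-1 => [|x]; first by rewrite invr_gt0.
have [->|x0] := eqVneq x 0; first by rewrite linear_map0// !nrm0 mulr0.
have xp := nrm_gt0 x0; have xn : nrm x != 0 by rewrite gt_eqF.
have rx : 0 < r / nrm x by rewrite divr_gt0.
have /hd : ball (0 : H) d ((r / nrm x)%:C *: x).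
  rewrite -ball_normE /ball_ /= sub0r normrN nrmE dE ltcR nrmZr gtr0_norm//.
  by rewrite divfK// /r ltr_pdivrMr// ltr_pMr// ltr1n.
rewrite sub0r normrN nrmE linear_mapZ// -[1]/(1%:C) lecR nrmZr gtr0_norm//.
by rewrite mulrAC ler_pdivrMr// mul1r ler_pdivlMl.
Qed.

Lemma linear_bound_continuous T M : linear T -> operator_bound T M -> continuous T.
Proof.
move=> lT hT a; apply/cvgrPdist_le => e e0.
have eE : e = (complex.Re e)%:C.
  by rewrite [LHS]complexE (ger0_Im (ltW e0)) rmorph0 mulr0 addr0.
have r0 : 0 < complex.Re e by rewrite -ltcR -eE.
pose N := Num.max M 1; have N0 : 0 < N by rewrite lt_max ltr01 orbT.
have rN : 0 < (complex.Re e / N)%:C by rewrite -[0]/(0%:C) ltcR divr_gt0.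
apply/nbhs_ballP; exists (complex.Re e / N)%:C => // x.
rewrite -ball_normE /ball_ /= !nrmE ltcR ltr_pdivlMr// => /ltW ax.
rewrite eE lecR -(linear_mapB lT) (le_trans (hT _))// (le_trans _ ax)// mulrC.
by rewrite ler_wpM2l ?nrm_ge0// le_max lexx.
Qed.

(** For S = A - l the failure of this property says that l is an approximate eigenvalue, which puts
    l in the spectrum and, unlike invertibility, needs no construction of an inverse. *)
Definition bounded_below S : Prop :=
  exists2 b : R, 0 < b & forall x, b * nrm x <= nrm (S x).

Lemma not_bounded_below_spectrum A (l : C) :
  ~ bounded_below (fun x => A x - l *: x) -> spectrum A l.
Proof.
move=> nb [S [[lS cS] SA _]]; apply: nb.
have [M M0 hM] := linear_continuous_bound lS cS.
exists M^-1 => [|x]; first by rewrite invr_gt0.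
by rewrite ler_pdivrMl// -{1}(SA x); exact: hM.
Qed.

Lemma bounded_below_large A M (l : C) : operator_bound A M ->
  M < complex.Re `|l| -> bounded_below (fun x => A x - l *: x).
Proof.
move=> AM Ml; exists (complex.Re `|l| - M) => [|x]; first by rewrite subr_gt0.
have := nrmB (A x) (A x - l *: x); rewrite opprB addrC subrK nrmZ mulrBl.
have := AM x; lra.
Qed.

(** Since <Ax, x> is real, <Ax - lx, x> has imaginary part - Im l |x|^2, and Cauchy-Schwarz turns
    this into the lower bound |Im l|. *)
Lemma bounded_below_nonreal A (l : C) :
  (forall x y, inner H (A x) y = inner H x (A y)) ->
  complex.Im l != 0 -> bounded_below (fun x => A x - l *: x).
Proof.
move=> sA l0; exists `|complex.Im l| => [|x]; first by rewrite normr_gt0.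
have [->|x0] := eqVneq x 0; first by rewrite nrm0 mulr0 nrm_ge0.
have Im0 : complex.Im (inner H (A x) x) = 0.
  have : inner H (A x) x = Num.conj (inner H (A x) x) by rewrite -innerC sA.
  by case: (inner H (A x) x) => a b [] /eqP; rewrite -addr_eq0 -mulr2n mulrn_eq0 /= => /eqP.
have ImE : complex.Im (inner H (A x - l *: x) x) = - (complex.Im l * nrm x ^+ 2).
  rewrite innerBl innerZl inner_self; move: Im0.
  case: (inner H (A x) x) => a b /= ->; case: l {l0} => c d; simpc.
  by [].
rewrite -(ler_pM2r (nrm_gt0 x0)) -mulrA -expr2 -lecR.
apply: le_trans (inner_norm_le _ _).
have -> : `|complex.Im l| * nrm x ^+ 2 = `|complex.Im (inner H (A x - l *: x) x)|.
  by rewrite ImE normrN normrM (ger0_norm (sqr_ge0 _)).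
case: (inner H _ x) => a b /=.
by rewrite normc_def /= lecR -sqrtr_sqr ler_wsqrtr// lerDr sqr_ge0.
Qed.

Lemma poly_opX A x : poly_op 'X A x = A x.
Proof. by rewrite -['X]mul1r poly_opMX -polyC1 poly_opC scale1r. Qed.

Lemma poly_op_XsubC (z : C) A x : poly_op ('X - z%:P) A x = A x - z *: x.
Proof. by rewrite -polyCN poly_opD poly_opX poly_opC scaleNr. Qed.

Lemma bounded_below_prod A (r : seq C) : linear A ->
  (forall z, z \in r -> bounded_below (fun x => A x - z *: x)) ->
  bounded_below (poly_op (\prod_(z <- r) ('X - z%:P)) A).
Proof.
move=> lA; elim: r => [|z r ih] h.
  by exists 1 => // x; rewrite big_nil -polyC1 poly_opC scale1r mul1r.
have [b b0 hb] := h z (mem_head _ _).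
have [|c c0 hc] := ih; first by move=> y yr; apply: h; rewrite inE yr orbT.
exists (b * c) => [|x]; first exact: mulr_gt0.
rewrite big_cons poly_opM// poly_op_XsubC; apply: le_trans (hb _).
by rewrite -mulrA; apply: ler_wpM2l (hc _); exact: ltW.
Qed.

(** The half of spectral mapping that is used: q splits into linear factors over the complex
    numbers, and if every A - z were bounded below, so would be their product. *)
Lemma not_bounded_below_root A (q : {poly C}) : linear A -> q != 0 ->
  ~ bounded_below (poly_op q A) ->
  exists2 z, root q z & ~ bounded_below (fun x => A x - z *: x).
Proof.
move=> lA q0 nb; have [r qE] := closed_field_poly_normal q.
have lq : lead_coef q != 0 by rewrite lead_coef_eq0.
apply: contrapT => h; apply: nb.
have [|b b0 hb] := @bounded_below_prod A r lA.
  move=> z zr; apply: contrapT => nz; apply: h; exists z => //.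
  by rewrite qE rootZ// root_prod_XsubC.
exists (complex.Re `|lead_coef q| * b) => [|x].
  by rewrite mulr_gt0// -ltcR Re_normC normr_gt0.
by rewrite {2}qE poly_opZ// nrmZ -mulrA ler_wpM2l ?Re_norm_ge0.
Qed.

(* c is the least bound of S, and S' its adjoint: if S' S - c^2 were bounded below
   by b, then |S x|^2 <= (c^2 - b^2 / c^2) |x|^2. *)
Lemma attained_bound S S' M (x0 : H) : linear S -> linear S' ->
  (forall x y, inner H (S x) y = inner H x (S' y)) ->
  0 <= M -> operator_bound S M -> x0 != 0 ->
  exists c : R, [/\ 0 <= c, operator_bound S c &
    ~ bounded_below (fun x => S' (S x) - (c ^+ 2)%:C *: x)].
Proof.
move=> lS lS' adj M0 SM x00; pose E := [set c | 0 <= c /\ operator_bound S c].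
have E0 : E !=set0 by exists M.
have lbE : has_lbound E by exists 0 => c [].
have c0 : 0 <= inf E by apply: lb_le_inf => // c [].
have cS : operator_bound S (inf E).
  move=> x; have [->|xn0] := eqVneq x 0; first by rewrite linear_map0// !nrm0 mulr0.
  rewrite -ler_pdivrMr ?nrm_gt0//; apply: lb_le_inf => // c [_ hc].
  by rewrite ler_pdivrMr ?nrm_gt0.
have cmin c : 0 <= c -> operator_bound S c -> inf E <= c.
  by move=> ? ?; apply: ge_inf.
exists (inf E); split => // -[b b0 hb]; move: (inf E) => c in c0 cS cmin hb.
(* The adjoint obeys the same bound, by |S'y|^2 = <S S'y, y> and Cauchy-Schwarz. *)
have S'c : operator_bound S' c.
  move=> y; have [->|yn0] := eqVneq (nrm (S' y)) 0; first by rewrite mulr_ge0 ?nrm_ge0.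
  have yp : 0 < nrm (S' y) by rewrite lt_neqAle eq_sym yn0 nrm_ge0.
  rewrite -(ler_pM2r yp) -expr2.
  have -> : nrm (S' y) ^+ 2 = complex.Re (inner H (S (S' y)) y) by rewrite adj inner_self.
  by rewrite (le_trans (Re_inner_le _ _))// mulrAC ler_wpM2r ?nrm_ge0.
(* The division by c^2 below needs c > 0. If c = 0 then S vanishes, and the nonzero [x0] contradicts
   the lower bound b. *)
have [c_eq0|c_neq0] := eqVneq c 0.
  have S0 x : S x = 0.
    by apply/nrm_eq0/eqP; rewrite eq_le nrm_ge0 andbT -(mul0r (nrm x)) -c_eq0 cS.
  have := hb x0; rewrite S0 linear_map0// c_eq0 expr0n scale0r subrr nrm0.
  by rewrite leNgt mulr_gt0// nrm_gt0.
have cp : 0 < c by rewrite lt_neqAle eq_sym c_neq0.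
have c2p : 0 < c ^+ 2 by rewrite exprn_gt0.
pose k := c ^+ 2 - b ^+ 2 / c ^+ 2.
(* Expand b^2 |x|^2 <= |S'Sx - c^2 x|^2, whose cross term is -2 c^2 |Sx|^2, and use |S'Sx| <= c
   |Sx|. *)
have hk x : nrm (S x) ^+ 2 <= k * nrm x ^+ 2.
  have h1 : nrm (S' (S x)) ^+ 2 <= c ^+ 2 * nrm (S x) ^+ 2.
    by rewrite -exprMn lerXn2r ?nnegrE ?mulr_ge0 ?nrm_ge0.
  have h2 : complex.Re (inner H ((c ^+ 2)%:C *: x) (S' (S x))) = c ^+ 2 * nrm (S x) ^+ 2.
    by rewrite innerZl -adj inner_self -rmorphM.
  have : (b * nrm x) ^+ 2 <= nrm (S' (S x) - (c ^+ 2)%:C *: x) ^+ 2.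
    by rewrite lerXn2r ?nnegrE ?mulr_ge0 ?nrm_ge0 ?(ltW b0).
  rewrite nrm_dist nrm_sqrB h2 nrmZr exprMn (gtr0_norm c2p) => h3.
  rewrite -(ler_pM2l c2p) (_ : c ^+ 2 * (k * _) = c ^+ 2 ^+ 2 * nrm x ^+ 2 - b ^+ 2 * nrm x ^+ 2).
    by move: h1 h3; rewrite !exprMn; lra.
  by rewrite /k; field.
have k0 : 0 <= k.
  by rewrite -(pmulr_lge0 _ (exprn_gt0 2 (nrm_gt0 x00))) (le_trans _ (hk x0))// sqr_ge0.
have : c <= Num.sqrt k.
  apply: cmin => [|x]; first exact: sqrtr_ge0.
  by rewrite -(@ler_pXn2r _ 2) ?nnegrE ?mulr_ge0 ?nrm_ge0 ?sqrtr_ge0// exprMn sqr_sqrtr.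
rewrite -(@ler_pXn2r _ 2) ?nnegrE ?sqrtr_ge0// sqr_sqrtr// /k.
have : 0 < b ^+ 2 / c ^+ 2 by rewrite divr_gt0// exprn_gt0.
by set u := _ / _; lra.
Qed.

Lemma conj_real (r : R) : Num.conj r%:C = r%:C :> C.
Proof. exact: conjc_real. Qed.

(* With S = p(A), attained_bound makes q(A) not bounded below, q = p^* p - c^2;
   so A - z is not bounded below for some root z of q, which is a real point of
   the spectrum where |p| = c. *)
Lemma poly_op_spectral_bound A M (p : {poly C}) d : linear A ->
  (forall x y, inner H (A x) y = inner H x (A y)) -> 0 <= M -> operator_bound A M ->
  (forall t : R, -M <= t <= M -> spectrum A t%:C -> nrm (p.[t%:C] : C^o) <= d) ->
  operator_bound (poly_op p A) d.
Proof.
move=> lA sA M0 AM hp x0.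
have [->|x00] := eqVneq x0 0.
  by rewrite (linear_map0 (poly_op_linear p lA)) !nrm0 mulr0.
have point q : q != 0 -> ~ bounded_below (poly_op q A) ->
    exists t : R, [/\ root q t%:C, -M <= t <= M & spectrum A t%:C].
  move=> q0 /(not_bounded_below_root lA q0)[z qz nz].
  have zR : z = (complex.Re z)%:C.
    apply/eqP; rewrite eq_complex /= eqxx /=; apply/negPn/negP => z0.
    by apply: nz; exact: bounded_below_nonreal.
  exists (complex.Re z); rewrite -zR; split=> //; last exact: not_bounded_below_spectrum.
  rewrite -ler_norml -Re_norm_real -zR leNgt; apply/negP => Mz.
  by apply: nz; exact: bounded_below_large AM Mz.
(* When p^* p - c^2 is the zero polynomial (p constant, say) it has no factors to exploit, but then
   any real spectral point will do; the same argument with S = A provides one. *)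
have [t0 [t0M t0s]] : exists t : R, -M <= t <= M /\ spectrum A t%:C.
  have [c [c0 _ nb]] := attained_bound lA lA sA M0 AM x00.
  have [|q_bb|t [_ tM ts]] := point ('X ^+ 2 - ((c ^+ 2)%:C)%:P).
  - by rewrite -size_poly_eq0 size_XnsubC.
  - apply: nb; have [b b0 hb] := q_bb; exists b => // x.
    by rewrite (le_trans (hb x))// poly_opB// poly_opC expr2 poly_opMX poly_opX.
  - by exists t.
have [N N0 pN] := poly_op_bound H p M0.
pose p' := map_poly Num.conj p.
have [c [c0 pc nb]] := attained_bound (poly_op_linear p lA) (poly_op_linear p' lA)
  (fun x y => @poly_op_adjoint _ _ p A x y lA sA) N0 (pN _ AM) x00.
have root_c (t : R) : root (p' * p - ((c ^+ 2)%:C)%:P) t%:C -> nrm (p.[t%:C] : C^o) = c.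
  rewrite rootE !hornerE subr_eq0 /p' -{1}(conj_real t) horner_map -normCKC => /eqP.
  rewrite -Re_normC -rmorphXn => /complexI/eqP; rewrite eqrXn2// ?Re_norm_ge0// => /eqP.
  by [].
suff [t [tM ts rt]] : exists t : R, [/\ -M <= t <= M, spectrum A t%:C &
    root (p' * p - ((c ^+ 2)%:C)%:P) t%:C].
  by rewrite (le_trans (pc _))// ler_wpM2r ?nrm_ge0// -(root_c t)// hp.
have [q0|q0] := eqVneq (p' * p - ((c ^+ 2)%:C)%:P) 0.
  by exists t0; rewrite q0 root0.
have [|t [rt tM ts]] := point _ q0; last by exists t.
move=> [b b0 hb]; apply: nb; exists b => // x.
by rewrite (le_trans (hb x))// poly_opB// poly_opC poly_opM.
Qed.

Lemma geometric_cvg (u : nat -> H) (D r : R) : 0 <= D -> 0 <= r < 1 ->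
  (forall n, nrm (u n.+1 - u n) <= D * r ^+ n) -> cvgn u.
Proof.
move=> D0 /andP[r0 r1] hu; have s0 : 0 < 1 - r by rewrite subr_gt0.
have tail n k : nrm (u (n + k)%N - u n) <= D * r ^+ n / (1 - r).
  (* The exact partial geometric sum is what the induction on k can carry; the term r^(n + k) is
     dropped afterwards. *)
  have : nrm (u (n + k)%N - u n) <= D * (r ^+ n - r ^+ (n + k)) / (1 - r).
    elim: k => [|k ih]; first by rewrite addn0 !subrr nrm0 mulr0 mul0r.
    rewrite addnS (le_trans (nrm_distD (u (n + k)%N) _ _))//.
    rewrite (le_trans (lerD (hu _) ih))// le_eqVlt; apply/orP; left; apply/eqP.
    by rewrite exprS; field; rewrite gt_eqF.
  move=> /le_trans; apply; rewrite ler_pM2r ?invr_gt0// ler_wpM2l// gerBl.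
  exact: exprn_ge0.
apply: cauchy_nrm_cvg => e e0.
have : (fun n => r ^+ n) @ \oo --> (0 : R).
  by apply: cvg_expr; rewrite ger0_norm.
move=> /cvgrPdist_le/(_ (e * (1 - r) / (2 * (D + 1)))) [|N _ hN].
  by rewrite divr_gt0 ?mulr_gt0// ltr_wpDl.
have rN : D * r ^+ N / (1 - r) <= e / 2.
  have := hN N (leqnn _); rewrite /= sub0r normrN ger0_norm ?exprn_ge0//.
  rewrite ler_pdivlMr ?mulr_gt0 ?ltr_wpDl// ler_pdivrMr// => h.
  have := exprn_ge0 N r0; nra.
exists N => m n Nm Nn; rewrite -(subnKC Nm) -(subnKC Nn).
have := nrm_distD (u N) (u (N + (m - N))%N) (u (N + (n - N))%N).
have := tail N (m - N)%N; have := tail N (n - N)%N; rewrite (nrm_dist (u N)); lra.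
Qed.

(** The map u |-> (Au - y) / t contracts with ratio M / |t| < 1, and its fixed point solves the
    equation; [u] iterates it from 0. *)
Lemma neumann_surjective A M (t : R) : linear A -> operator_bound A M -> 0 <= M -> M < `|t| ->
  forall y, exists x, A x - t%:C *: x = y.
Proof.
move=> lA AM M0 Mt y.
have tp : 0 < `|t| := le_lt_trans M0 Mt.
have t0 : t != 0 by rewrite -normr_gt0.
pose u := fix u n := if n is m.+1 then (t^-1)%:C *: (A (u m) - y) else 0.
have uS n : t%:C *: u n.+1 = A (u n) - y.
  by rewrite /= scalerA -rmorphM mulfV// scale1r.
have hu n : nrm (u n.+1 - u n) <= nrm (u 1%N) * (M / `|t|) ^+ n.
  elim: n => [|n ih]; first by rewrite expr0 mulr1 subr0.
  have -> : u n.+2 - u n.+1 = (t^-1)%:C *: A (u n.+1 - u n).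
    by rewrite (linear_mapB lA) [u n.+2]/= [in X in _ - X]/= -scalerBr opprB addrA subrK.
  rewrite nrmZr normfV mulrC ler_pdivrMr// (le_trans (AM _))//.
  have -> : nrm (u 1%N) * (M / `|t|) ^+ n.+1 * `|t| = M * (nrm (u 1%N) * (M / `|t|) ^+ n).
    by rewrite exprS; field; rewrite gt_eqF.
  exact: ler_wpM2l.
have /cvg_ex[/= l ul] : cvgn u.
  apply: geometric_cvg (nrm_ge0 _) _ hu.
  by rewrite divr_ge0 ?(ltW tp)//= ltr_pdivrMr// mul1r.
exists l; apply: eq_of_nrm => e e0.
have d0 : 0 < e / (M + `|t|) by rewrite divr_gt0// ltr_wpDl.
have d0' : 0 < (e / (M + `|t|))%:C by rewrite -[0]/(0%:C) ltcR.
have /cvgrPdist_le/(_ _ d0')[N _ hN] := ul.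
have h1 : nrm (l - u N) <= e / (M + `|t|) by rewrite -lecR -nrmE; exact: (hN N (leqnn _)).
have h2 : nrm (l - u N.+1) <= e / (M + `|t|) by rewrite -lecR -nrmE; exact: (hN N.+1 (leqnSn _)).
have -> : A l - t%:C *: l - y = A (l - u N) - t%:C *: (l - u N.+1).
  by rewrite (linear_mapB lA) scalerBr uS opprB addrA subrKA addrAC.
rewrite (le_trans (nrmB _ _))// nrmZr (le_trans (lerD (AM _) (lexx _)))//.
have -> : e = M * (e / (M + `|t|)) + `|t| * (e / (M + `|t|)).
  by rewrite -mulrDl mulrC divfK// gt_eqF// ltr_wpDl.
by rewrite lerD// ler_wpM2l// ltW.
Qed.

(** If |t| > M, then A - t is bounded below and onto, so it has a bounded inverse. This lets
    approximation on [-M, M] meet the condition on the spectrum in [is_functional_calculus]. *)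
Lemma spectrum_real_bound A M (t : R) : linear A -> operator_bound A M -> 0 <= M ->
  spectrum A t%:C -> `|t| <= M.
Proof.
move=> lA AM M0 st; rewrite leNgt; apply/negP => Mt; apply: st.
have [b b0 hb] : bounded_below (fun x => A x - t%:C *: x).
  by apply: bounded_below_large AM _; rewrite Re_norm_real.
have [S SP] := choice (neumann_surjective lA AM M0 Mt).
have lAt : linear (fun x => A x - t%:C *: x).
  move=> a x y; rewrite lA scalerDr scalerBr !scalerA (mulrC _ a).
  by rewrite opprD addrACA -!scalerA.
have inj x y : A x - t%:C *: x = A y - t%:C *: y -> x = y.
  move=> h; apply/eqP; rewrite -subr_eq0; apply/eqP/nrm_eq0/eqP.
  rewrite eq_le nrm_ge0 andbT -(pmulr_rle0 _ b0) (le_trans (hb _))//.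
  by rewrite (linear_mapB lAt) h subrr nrm0.
have lS : linear S by move=> a x y; apply: inj; rewrite SP lAt !SP.
exists S; split => // [|x]; last by apply: inj; rewrite SP.
split => //; apply: (@linear_bound_continuous _ b^-1) => // x.
by rewrite ler_pdivlMl// -{2}(SP x).
Qed.
End BoundedOperators.

(** * Functional calculus *)

Section FunctionalCalculus.
Variables (R : realType) (H : hilbert R).
Local Notation C := R[i].
Implicit Types (A T : H -> H) (f : R -> C^o) (p q : {poly C}).

Lemma normC_le (z : C) (d : R) : (`|z| <= d%:C) = (nrm (z : C^o) <= d).
Proof. by rewrite -lecR Re_normC. Qed.

Lemma linear_sub A T : linear A -> linear T -> linear (A - T)%R.
Proof.
by move=> lA lT a x y; rewrite !fun_subE lA lT opprD addrACA -scalerBr.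
Qed.

Lemma exists_inv_le (c e : R) : 0 < e -> exists n : nat, c / n.+1%:R <= e.
Proof.
move=> e0; exists (Num.truncn (c / e)); have := truncnS_gt (c / e).
by rewrite ltr_pdivrMr// ler_pdivrMr ?ltr0n// mulrC => /ltW.
Qed.

(** Both restrictions on t matter for later use: one polynomial may be close to f only on the
    spectrum, a Weierstrass approximant only on [-M, M]. *)
Lemma poly_op_dist A M p q d : bounded_self_adjoint A -> 0 <= M -> operator_bound A M ->
  (forall t : R, -M <= t <= M -> spectrum A t%:C -> nrm (p.[t%:C] - q.[t%:C] : C^o) <= d) ->
  operator_bound (poly_op p A - poly_op q A)%R d.
Proof.
move=> [[lA _] sA] M0 AM pq x.
rewrite fun_subE -poly_opB//; apply: (poly_op_spectral_bound lA sA M0 AM) => t tM ts.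
by rewrite !hornerE pq.
Qed.

(** T is the limit of p_n(A) for Weierstrass approximants p_n. The sequence is Cauchy by the
    spectral bound, at a rate relative to |x|, which also makes T bounded. *)
Lemma functional_calculus_exists f A : continuous f -> bounded_self_adjoint A ->
  exists T, is_functional_calculus f A T.
Proof.
move=> cf bA; have [[lA cA] sA] := bA.
have [M M0 AM] := linear_continuous_bound lA cA; have {M0} M0 := ltW M0.
have approx (n : nat) : exists p : {poly C}, forall t, -M <= t <= M ->
    nrm (p.[t%:C] - f t : C^o) <= n.+1%:R^-1.
  by apply: weierstrass => //; rewrite invr_gt0 ltr0n.
have [p pf] := choice approx.
have pdist m n x : (n <= m)%N ->
    nrm (poly_op (p n) A x - poly_op (p m) A x) <= 2 / n.+1%:R * nrm x.
  move=> nm; apply: (poly_op_dist bA M0 AM) => t tM _.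
  rewrite (le_trans (nrm_distD (f t : C^o) _ _))//.
  rewrite (nrm_dist (f t : C^o)).
  have pm := pf m t tM; have pn := pf n t tM;
  rewrite mulr_natl mulr2n lerD// (le_trans pm)// lef_pV2 ?posrE ?ltr0n//.
  by rewrite ler_nat.
have cvgp x : cvgn (fun n => poly_op (p n) A x).
  apply: cauchy_nrm_cvg => e e0.
  have [N hN] := exists_inv_le (4 * nrm x) e0; exists N => m n Nm Nn.
  rewrite (le_trans (nrm_distD (poly_op (p N) A x) _ _))// nrm_dist.
  rewrite (le_trans (lerD (pdist _ _ _ Nm) (pdist _ _ _ Nn)))// (le_trans _ hN)//.
  by rewrite le_eqVlt; apply/orP; left; apply/eqP; ring.
pose T x := limn (fun n => poly_op (p n) A x).
have TP x : (fun n => poly_op (p n) A x) @ \oo --> T x := cvgp x.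
have Tdist n x : nrm (poly_op (p n) A x - T x) <= 2 / n.+1%:R * nrm x.
  by apply: cvg_nrm_le (TP x) _ => m; exact: pdist.
have lT : linear T.
  move=> a x y; apply: (cvg_unique _ (TP (a *: x + y))); first exact: norm_hausdorff.
  rewrite (_ : (fun n => _) = fun n => a *: poly_op (p n) A x + poly_op (p n) A y); last first.
    by apply/funext => n; rewrite (poly_op_linear (p n) lA).
  by apply: cvgD => //; apply: cvgZr.
exists T; split.
  split=> //; have [N N0 hN] := poly_op_bound H (p 0%N) M0.
  apply: (@linear_bound_continuous _ _ _ (N + 2)) => // x.
  rewrite -[T x](subrK (poly_op (p 0%N) A x)) (le_trans (nrmD _ _))// nrm_dist mulrDl addrC.
  by rewrite lerD ?hN// (le_trans (Tdist _ _))// divr1.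
move=> e e0; exists (e / 2); first by rewrite divr_gt0.
move=> q qf; apply/operator_norm_leP.
- by apply: linear_sub lT; exact: poly_op_linear.
- exact: ltW.
(* The 3 adds 1 / (n + 1) from p_n against f and 2 / (n + 1) from p_n(A) against T; q against f
   takes the other e / 2. *)
move=> x; have [n hn] := exists_inv_le 3 (divr_gt0 e0 (@ltr0n R 2)).
rewrite fun_subE (le_trans (nrm_distD (poly_op (p n) A x) _ _))//.
have h1 : nrm (poly_op q A x - poly_op (p n) A x) <= (e / 2 + n.+1%:R^-1) * nrm x.
  apply: (poly_op_dist bA M0 AM) => t tM ts.
  rewrite (le_trans (nrm_distD (f t : C^o) _ _))// lerD//.
    by rewrite -normC_le qf.
  by rewrite nrm_dist pf.
rewrite (le_trans (lerD h1 (Tdist n x)))// -mulrDl ler_wpM2r ?nrm_ge0//.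
by move: hn; set k := _^-1; lra.
Qed.

Lemma functional_calculusP f A : continuous f -> bounded_self_adjoint A ->
  is_functional_calculus f A (functional_calculus f A).
Proof. by move=> cf bA; have [T hT] := functional_calculus_exists cf bA; exact: (xgetI 0 hT). Qed.

Lemma functional_calculus_linear f A : linear (functional_calculus f A).
Proof.
rewrite /functional_calculus; case: xgetP => [T _ [[lT _] _]//|_].
by move=> a x y; rewrite scaler0 addr0.
Qed.

(** The definition of f(A) gives no rate. An auxiliary q within min(d, r) of f puts q(A) within r of
    f(A) and within e + r of p(A); the loss 2 r then tends to 0. *)
Lemma functional_calculus_dist f A M p e : continuous f -> bounded_self_adjoint A ->
  0 <= M -> operator_bound A M ->
  (forall t, -M <= t <= M -> nrm (p.[t%:C] - f t : C^o) <= e) ->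
  operator_bound (poly_op p A - functional_calculus f A)%R e.
Proof.
move=> cf bA M0 AM pf x; have [[lA _] sA] := bA.
have [_ fc] := functional_calculusP cf bA.
apply: (@le_of_eps _ _ _ (2 * nrm x)) => [|r r0]; first by rewrite mulr_ge0 ?nrm_ge0.
have [d d0 hd] := fc _ r0.
have dr0 : 0 < Num.min d r by rewrite lt_min d0.
have [q qf] := weierstrass M cf dr0.
have /operator_norm_leP h1 :
    (op_norm (op_graph (poly_op q A - functional_calculus f A)%R) <= r%:E)%E.
  apply: hd => t /(spectrum_real_bound lA AM M0); rewrite ler_norml => tM.
  by rewrite normC_le (le_trans (qf _ tM))// ge_min lexx.
rewrite fun_subE (le_trans (nrm_distD (poly_op q A x) _ _))//.
have h2 : nrm (poly_op p A x - poly_op q A x) <= (e + r) * nrm x.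
  apply: (poly_op_dist bA M0 AM) => t tM _.
  rewrite (le_trans (nrm_distD (f t : C^o) _ _))// lerD ?pf//.
  by rewrite nrm_dist (le_trans (qf _ tM))// ge_min lexx orbT.
have := h1 (linear_sub (poly_op_linear q lA) (functional_calculus_linear f A)) (ltW r0) x.
rewrite fun_subE; move: h2; lra.
Qed.
End FunctionalCalculus.

(** * Finite dimensional compressions *)

Section Compression.
Variables (R : realType) (K H : hilbert R).
Local Notation C := R[i].

(* V W is the orthogonal projection onto a subspace of K that W maps isometrically
   into H; this avoids choosing bases of finite dimensional subspaces. *)
Record partial_isometry (V : H -> K) (W : K -> H) : Prop := PartialIsometry {
  pisoV_linear : linear V;
  pisoW_linear : linear W;
  piso_adj : forall y z, inner K (V y) z = inner H y (W z);
  pisoK : forall z, W (V (W z)) = W z }.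

Section Theory.
Variables (V : H -> K) (W : K -> H).
Hypothesis VW : partial_isometry V W.

Lemma piso_adjC y z : inner H (W z) y = inner K z (V y).
Proof. by rewrite innerC -(piso_adj VW) -innerC. Qed.

Lemma pisoVK y : V (W (V y)) = V y.
Proof.
apply: inner_injl => z; rewrite (piso_adj VW) piso_adjC.
by rewrite (piso_adj VW) (pisoK VW) -(piso_adj VW).
Qed.

Lemma pisoW_le z : nrm (W z) <= nrm z.
Proof.
have eqn : nrm (V (W z)) = nrm (W z).
  apply: (@pexpIrn _ 2); rewrite ?nnegrE ?nrm_ge0//; apply: complexI.
  by rewrite -!inner_self (piso_adj VW) (pisoK VW).
have [->|W0] := eqVneq (nrm (W z)) 0; first exact: nrm_ge0.
have Wp : 0 < nrm (W z) by rewrite lt_neqAle eq_sym W0 nrm_ge0.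
rewrite -(ler_pM2l Wp) -expr2.
have -> : nrm (W z) ^+ 2 = complex.Re (inner K (V (W z)) z).
  by rewrite (piso_adj VW) inner_self.
by rewrite -eqn Re_inner_le.
Qed.

Lemma pisoV_le y : nrm (V y) <= nrm y.
Proof.
have [->|V0] := eqVneq (nrm (V y)) 0; first exact: nrm_ge0.
have Vp : 0 < nrm (V y) by rewrite lt_neqAle eq_sym V0 nrm_ge0.
rewrite -(ler_pM2r Vp) -expr2.
have -> : nrm (V y) ^+ 2 = complex.Re (inner H y (W (V y))).
  by rewrite -(piso_adj VW) inner_self.
by rewrite (le_trans (Re_inner_le _ _))// ler_wpM2l ?nrm_ge0// pisoW_le.
Qed.

Lemma pisoW_isometric z : V (W z) = z -> nrm (W z) = nrm z.
Proof.
move=> zE; apply: (@pexpIrn _ 2); rewrite ?nnegrE ?nrm_ge0//; apply: complexI.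
by rewrite -!inner_self -(piso_adj VW) zE.
Qed.

Lemma compression_bound (A : K -> K) M : 0 <= M -> operator_bound A M ->
  operator_bound (W \o A \o V) M.
Proof.
move=> M0 AM y /=; rewrite (le_trans (pisoW_le _))// (le_trans (AM _))//.
by rewrite ler_wpM2l// pisoV_le.
Qed.

Lemma compression_finite_rank (A : K -> K) M : finitely_spanned (range W) ->
  0 <= M -> operator_bound A M -> bounded_self_adjoint A ->
  finite_rank_self_adjoint (W \o A \o V).
Proof.
move=> fW M0 AM [[lA _] sA].
have lWAV : linear (W \o A \o V).
  by move=> a x y /=; rewrite (pisoV_linear VW) lA (pisoW_linear VW).
split.
  split; first by split=> //; apply: linear_bound_continuous lWAV (compression_bound M0 AM).
  by move=> x y /=; rewrite piso_adjC sA (piso_adj VW).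
have [n [v hv]] := fW; exists n, v => _ [x _ <-].
by apply: hv; exists (A (V x)).
Qed.
End Theory.

Lemma finitely_spanned_add (S T : set H) (h : H) : finitely_spanned S ->
  (forall x, T x -> exists y a, S y /\ x = y + a *: h) -> finitely_spanned T.
Proof.
move=> [n [v hv]] hT.
exists n.+1, (fun i => if unlift ord0 i is Some j then v j else h) => x /hT[y [a [Sy ->]]].
have [c ->] := hv _ Sy.
exists (fun i => if unlift ord0 i is Some j then c j else a).
rewrite big_ord_recl unlift_none addrC; congr (_ + _).
by apply: eq_bigr => i _; rewrite liftK.
Qed.

(* Gram-Schmidt: the range of W grows by a unit vector h orthogonal to it, which
   V then sends to the normalized residual e of the new vector. *)
Lemma partial_isometry_extends (s : seq K) : infinite_dimensional H ->
  exists (V : H -> K) (W : K -> H), [/\ partial_isometry V W,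
    finitely_spanned (range W) & forall v, v \in s -> V (W v) = v].
Proof.
move=> Hinf; elim: s => [|v s [V [W [VW fW hs]]]].
  exists (fun=> 0), (fun=> 0); split=> //.
  - split=> //; try by move=> a x y; rewrite scaler0 addr0.
    by move=> y z; rewrite inner0l inner0r.
  - by exists 0%N, (fun=> 0) => _ [x _ <-]; exists (fun=> 0); rewrite big_ord0.
have lV := pisoV_linear VW; have lW := pisoW_linear VW.
have [vE|vN] := eqVneq (V (W v)) v.
  by exists V, W; split=> // u; rewrite inE => /orP[/eqP->|/hs].
(* Infinite dimension enters here: otherwise the finitely spanned range of W would be all of H, with
   no room for a new direction. *)
have [y yN] : exists y, y - W (V y) != 0.
  apply: contrapT => hy; apply: Hinf; have [n [w hw]] := fW.
  exists n, w => x _; apply: hw; exists (V x) => //.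
  apply/eqP; rewrite eq_sym -subr_eq0; apply/negPn/negP => xn.
  by apply: hy; exists x.
have [a a0 ha] := exists_unit yN; set h := a *: _ in ha.
have u0 : v - V (W v) != 0 by rewrite subr_eq0 eq_sym.
have [b b0 hb] := exists_unit u0; set e := b *: _ in hb.
have Vh : V h = 0.
  by rewrite /h (linear_mapZ lV) (linear_mapB lV) (pisoVK VW) subrr scaler0.
have We : W e = 0.
  by rewrite /e (linear_mapZ lW) (linear_mapB lW) (pisoK VW) subrr scaler0.
have We' z : inner H (W z) h = 0 by rewrite (piso_adjC VW) Vh inner0r.
have Ve' z : inner K (V z) e = 0 by rewrite (piso_adj VW) We inner0r.
(* As e is orthogonal to the range of V, the coefficient of the residual along e can be read off
   from v itself. *)
have eE : inner K v e *: e = v - V (W v).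
  have ve : inner K v e = inner K (v - V (W v)) e by rewrite innerBl Ve' subr0.
  have := hb; rewrite {1}/e innerZl => hbe.
  by rewrite ve {2}/e scalerA mulrC hbe scale1r.
move: e h => e h in ha hb Vh We We' Ve' eE *.
pose V' z := V z + inner H z h *: e; pose W' z := W z + inner K z e *: h.
have VW' z : V' (W' z) = V (W z) + inner K z e *: e.
  rewrite /V' /W' (linear_mapD lV) (linear_mapZ lV) Vh scaler0 addr0.
  by rewrite innerDl We' add0r innerZl ha mulr1.
exists V', W'; split.
- split.
  + by move=> c x z; rewrite /V' lV innerDl innerZl scalerDl scalerDr scalerA addrACA.
  + by move=> c x z; rewrite /W' lW innerDl innerZl scalerDl scalerDr scalerA addrACA.
  + move=> x z; rewrite /V' /W' innerDl innerDr innerZl innerZr (piso_adj VW) -innerC.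
    by rewrite mulrC.
  + move=> z; rewrite VW' /W' (linear_mapD lW) (linear_mapZ lW) We scaler0 addr0 (pisoK VW).
    by rewrite innerDl Ve' add0r innerZl hb mulr1.
- apply: (finitely_spanned_add fW (h := h)) => _ [z _ <-].
  by exists (W z), (inner K z e); split=> //; exists z.
- move=> u; rewrite inE => /orP[/eqP->|us]; rewrite VW'.
    by rewrite eE addrC subrK.
  by rewrite hs// -(hs _ us) Ve' scale0r addr0 hs.
Qed.
End Compression.

(** * From pairs in the dense family to all pairs of self-adjoint operators *)

Section ModulusBound.
Variable R : realType.
Local Notation C := R[i].

Section OperatorDistance.
Variable H : hilbert R.
Implicit Types A B D : H -> H.

Lemma operator_bound_distC A B m : operator_bound (A - B)%R m -> operator_bound (B - A)%R m.
Proof. by move=> h x; have := h x; rewrite !fun_subE nrm_dist. Qed.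

Lemma operator_bound_distD B A D m n : operator_bound (A - B)%R m ->
  operator_bound (B - D)%R n -> operator_bound (A - D)%R (m + n).
Proof.
move=> h1 h2 x; have := h1 x; have := h2 x; rewrite !fun_subE.
by have := nrm_distD (B x) (A x) (D x); lra.
Qed.

Lemma operator_bound_le A m n : m <= n -> operator_bound A m -> operator_bound A n.
Proof. by move=> mn h x; rewrite (le_trans (h x))// ler_wpM2r ?nrm_ge0. Qed.

Lemma operator_bound_near A B m n : operator_bound A m ->
  operator_bound (B - A)%R n -> operator_bound B (m + n).
Proof.
move=> h1 h2 x; have := h1 x; have := h2 x; rewrite fun_subE.
by have := nrmD (B x - A x) (A x); rewrite subrK; lra.
Qed.

Lemma finite_rank_scale (c : R) A : finite_rank_self_adjoint A ->
  finite_rank_self_adjoint (fun x => c%:C *: A x).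
Proof.
move=> [[[lA cA] sA] [n [v hv]]]; split.
  split.
    have lcA : linear (fun x => c%:C *: A x).
      by move=> a x y; rewrite lA scalerDr !scalerA (mulrC a).
    split=> //; have [M M0 hM] := linear_continuous_bound lA cA.
    apply: (@linear_bound_continuous _ _ _ (`|c| * M)) => // x.
    by rewrite nrmZr -mulrA ler_wpM2l.
  by move=> x y; rewrite innerZl innerZr conj_real sA.
exists n, v => _ [x _ <-]; have [|d ->] := hv (A x); first by exists x.
exists (fun i => c%:C * d i); rewrite scaler_sumr.
by apply: eq_bigr => i _; rewrite scalerA.
Qed.
End OperatorDistance.

Lemma piso_poly_op (K H : hilbert R) (V : H -> K) (W : K -> H) (A : K -> K) (p : {poly C}) x :
  partial_isometry V W -> (forall i, (i < size p)%N -> V (W (iter i A x)) = iter i A x) ->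
  poly_op p (W \o A \o V) (W x) = W (poly_op p A x) /\
  V (W (poly_op p A x)) = poly_op p A x.
Proof.
move=> VW hA; have lW := pisoW_linear VW; have lV := pisoV_linear VW; split.
  apply: poly_op_intertwine => // i ip /=; rewrite hA//.
  by rewrite (leq_trans ip)// leq_pred.
rewrite /poly_op (linear_map_sum lW) (linear_map_sum lV).
by apply: eq_bigr => i _; rewrite (linear_mapZ lW) (linear_mapZ lV) hA.
Qed.

Lemma functional_calculus_modulus (H : hilbert R) (K0 : set (H -> H)) (f : R -> C^o) (t S : R) :
  infinite_dimensional H -> K0 `<=` @finite_rank_self_adjoint R H ->
  (forall A : H -> H, finite_rank_self_adjoint A -> forall e : R, 0 < e ->
     exists B : H -> H, K0 B /\ (op_norm (op_graph (A - B)%R) < e%:E)%E) ->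
  continuous f -> 0 < t -> 0 <= S ->
  (forall P Q, K0 P -> K0 Q -> (op_norm (op_graph (P - Q)%R) < t%:E)%E ->
    operator_bound (functional_calculus f P - functional_calculus f Q)%R S) ->
  forall (K : hilbert R) (A B : K -> K), bounded_self_adjoint A -> bounded_self_adjoint B ->
    (op_norm (op_graph (A - B)%R) <= t%:E)%E ->
    operator_bound (functional_calculus f A - functional_calculus f B)%R S.
Proof.
move=> Hinf K0_sub K0_dense cf t0 S0 hS K A B bA bB ABt x.
have [[lA cA] sA] := bA; have [[lB cB] sB] := bB.
have {}ABt : operator_bound (A - B)%R t.
  by apply/operator_norm_leP => //; [exact: linear_sub|exact: ltW].
have [MA MA0 hMA] := linear_continuous_bound lA cA.
have [MB MB0 hMB] := linear_continuous_bound lB cB.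
pose M := MA + MB; have M0 : 0 <= M by rewrite addr_ge0 ?ltW.
have AM : operator_bound A M by apply: operator_bound_le hMA; rewrite lerDl ltW.
have BM : operator_bound B M by apply: operator_bound_le hMB; rewrite lerDr ltW.
(* Six errors of size e: p against f at A, B, P and Q, and the replacement of each of the two
   compressions by P or Q inside p. *)
apply: (@le_of_eps _ _ _ (6 * nrm x)) => [|e e0]; first by rewrite mulr_ge0 ?nrm_ge0.
(* The radius is M + 1 because P and Q will lie within d <= 1 of compressions bounded by M. *)
have [p pf] := weierstrass (M + 1) cf e0.
have [|L L0 hL] := poly_op_lipschitz H p (_ : 0 <= M + 1); first by rewrite addr_ge0.
pose d := Num.min 1 (e / (L + 1)).
have d0 : 0 < d by rewrite lt_min ltr01 divr_gt0// ltr_wpDl.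
have d1 : d <= 1 by rewrite ge_min lexx.
have Ld : L * d <= e.
  have : d <= e / (L + 1) by rewrite ge_min lexx orbT.
  rewrite ler_pdivlMr ?ltr_wpDl// => h; have := ltW d0; lra.
pose h := Num.min 2^-1 (d / (2 * (M + 1))).
have M1 : 0 < M + 1 by rewrite ltr_wpDl.
have h0 : 0 < h by rewrite lt_min invr_gt0 ltr0n/= divr_gt0// mulr_gt0.
have h1 : h <= 2^-1 by rewrite ge_min lexx.
have hM : h * M <= d / 2.
  have : h <= d / (2 * (M + 1)) by rewrite ge_min lexx orbT.
  rewrite ler_pdivlMr ?mulr_gt0// => hh; have := ltW h0; lra.
(* The first term gives h M + e' <= d, the distance from a compression to its replacement; the
   second gives (1 - h) t + 2 e' < t, the strict bound on P - Q. *)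
pose e' := Num.min (d / 2) (h * t / 4).
have ht0 : 0 < h * t by rewrite mulr_gt0.
have e'0 : 0 < e' by rewrite lt_min !divr_gt0.
have e'd : e' <= d / 2 by rewrite ge_min lexx.
have e't : e' <= h * t / 4 by rewrite ge_min lexx orbT.
pose s := [seq iter i A x | i <- iota 0 (size p)] ++ [seq iter i B x | i <- iota 0 (size p)].
have [V [W [VW fW hs]]] := partial_isometry_extends s Hinf.
have sA_ i : (i < size p)%N -> V (W (iter i A x)) = iter i A x.
  by move=> ip; apply: hs; rewrite mem_cat; apply/orP; left;
    apply/mapP; exists i; rewrite ?mem_iota.
have sB_ i : (i < size p)%N -> V (W (iter i B x)) = iter i B x.
  by move=> ip; apply: hs; rewrite mem_cat; apply/orP; right;
    apply/mapP; exists i; rewrite ?mem_iota.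
have [pA VpA] := piso_poly_op VW sA_; have [pB VpB] := piso_poly_op VW sB_.
set A1 := W \o A \o V in pA; set B1 := W \o B \o V in pB.
have A1f : finite_rank_self_adjoint A1 := compression_finite_rank VW fW M0 AM bA.
have B1f : finite_rank_self_adjoint B1 := compression_finite_rank VW fW M0 BM bB.
have A1M : operator_bound A1 M := compression_bound VW M0 AM.
have B1M : operator_bound B1 M := compression_bound VW M0 BM.
have AB1 : operator_bound (A1 - B1)%R t.
  have := compression_bound VW (ltW t0) ABt; congr (operator_bound _ _).
  by apply/funext => y; rewrite /= !fun_subE (linear_mapB (pisoW_linear VW)).
have approx T : finite_rank_self_adjoint T -> operator_bound T M ->
    exists P, [/\ K0 P, bounded_self_adjoint P,
      operator_bound ((fun y => (1 - h)%:C *: T y) - P)%R e' & operator_bound (T - P)%R d].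
  move=> Tf TM; have Tf' := finite_rank_scale (1 - h) Tf.
  have [P [K0P hP]] := K0_dense _ Tf' _ e'0; exists P.
  have [bP _] := K0_sub _ K0P; have [[lP _] _] := bP; have [[[lT' _] _] _] := Tf'.
  have /(operator_norm_ltP _ (linear_sub lT' lP)) := hP.
  move=> [m /andP[_ /ltW me] /(operator_bound_le me) hm].
  split=> //; apply: (@operator_bound_le _ _ (h * M + e')); first by lra.
  apply: operator_bound_distD hm => y.
  rewrite fun_subE -{1}[T y]scale1r -scalerBl -rmorphB /= opprB addrC subrK.
  by rewrite nrmZr gtr0_norm// -mulrA ler_wpM2l// ltW.
have [P [K0P bP AP AP1]] := approx _ A1f A1M.
have [Q [K0Q bQ BQ BQ1]] := approx _ B1f B1M.
have PQt : (op_norm (op_graph (P - Q)%R) < t%:E)%E.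
  apply/operator_norm_ltP; first by apply: linear_sub; [case: bP => -[]|case: bQ => -[]].
  exists (e' + ((1 - h) * t + e')).
    by apply/andP; split; [have := mulr_ge0 (_ : 0 <= 1 - h) (ltW t0); lra|lra].
  apply: operator_bound_distD (operator_bound_distC AP) _.
  apply: operator_bound_distD BQ => y.
  rewrite fun_subE -scalerBr nrmZr ger0_norm; last by lra.
  by rewrite -mulrA ler_wpM2l ?AB1//; lra.
have PM : operator_bound P (M + 1).
  by apply: operator_bound_near A1M (operator_bound_le d1 (operator_bound_distC AP1)).
have QM : operator_bound Q (M + 1).
  by apply: operator_bound_near B1M (operator_bound_le d1 (operator_bound_distC BQ1)).
have M1' : M <= M + 1 by rewrite lerDl.
have fcA := functional_calculus_dist cf bA (ltW M1) (operator_bound_le M1' AM) pf.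
have fcB := functional_calculus_dist cf bB (ltW M1) (operator_bound_le M1' BM) pf.
have fcP := functional_calculus_dist cf bP (ltW M1) PM pf.
have fcQ := functional_calculus_dist cf bQ (ltW M1) QM pf.
have lin_of (T : H -> H) : bounded_self_adjoint T -> linear T by case=> -[].
have pAP := hL _ _ _ (lin_of _ A1f.1) (lin_of _ bP) (operator_bound_le M1' A1M) PM AP1 (ltW d0).
have pBQ := hL _ _ _ (lin_of _ B1f.1) (lin_of _ bQ) (operator_bound_le M1' B1M) QM BQ1 (ltW d0).
have chain1 := operator_bound_distD (operator_bound_distD (operator_bound_distD pAP fcP)
   (hS _ _ K0P K0Q PQt))
  (operator_bound_distD (operator_bound_distC fcQ) (operator_bound_distC pBQ)).
(* At W x the compressed polynomials return W (p(A)x - p(B)x), and W preserves the norm of this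
   vector because V W fixes it. *)
have := chain1 (W x); rewrite fun_subE pA pB -(linear_mapB (pisoW_linear VW)).
rewrite (pisoW_isometric VW); last first.
  by rewrite (linear_mapB (pisoW_linear VW)) (linear_mapB (pisoV_linear VW)) VpA VpB.
have Wx : nrm (W x) <= nrm x := pisoW_le VW x.
move=> c1.
have : nrm (poly_op p A x - poly_op p B x) <= (S + 4 * e) * nrm x.
  rewrite (le_trans c1)//; apply: (@le_trans _ _ ((S + 4 * e) * nrm (W x))).
    by rewrite ler_wpM2r ?nrm_ge0//; lra.
  by rewrite ler_wpM2l// addr_ge0// mulr_ge0// ltW.
have := fcA x; have := fcB x; rewrite !fun_subE.
have := nrm_distD (poly_op p A x) (functional_calculus f A x) (functional_calculus f B x).
have := nrm_distD (poly_op p B x) (poly_op p A x) (functional_calculus f B x).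
rewrite (nrm_dist (functional_calculus f A x) (poly_op p A x)); lra.
Qed.
End ModulusBound.

(** * Orthogonal sums *)

Section OrthogonalSum.
Variables (R : realType) (H : hilbert R).
Local Notation C := R[i].
Local Notation HS := (hilbert_sum H).
Implicit Types (x y : HS) (G : nat -> set (H * H)).

Lemma hsum_ext x y : (forall k, hcoord x k = hcoord y k) -> x = y.
Proof. by move=> xy; apply/val_inj/funext. Qed.

Lemma hsumD x y k : hcoord (x + y) k = hcoord x k + hcoord y k.
Proof. exact: hcoordD. Qed.

Lemma hsumZ (a : C) x k : hcoord (a *: x) k = a *: hcoord x k.
Proof. exact: hcoordZ. Qed.

Lemma hsum_nrm_le x (M : R) : 0 <= M ->
  (forall n, \sum_(0 <= k < n) nrm (hcoord x k) ^+ 2 <= M ^+ 2) -> nrm x <= M.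
Proof. by move=> M0 h; rewrite -lecR -nrmE; exact: hsum_norm_le. Qed.

Lemma hsum_partial_le x n : \sum_(0 <= k < n) nrm (hcoord x k) ^+ 2 <= nrm x ^+ 2.
Proof. exact: hsum_series_le. Qed.

Lemma finite_support_summable (u : nat -> H) N :
  (forall k, (N <= k)%N -> u k = 0) -> u \in @l2pred R H.
Proof.
move=> u0; rewrite inE; apply/square_summableP.
exists (\sum_(0 <= k < N) nrm (u k) ^+ 2) => n; rewrite /series /=.
have [nN|/ltnW Nn] := leqP n N.
  rewrite (big_cat_nat (leq0n n) nN)//= lerDl.
  by apply: sumr_ge0 => i _; exact: sqr_ge0.
rewrite (big_cat_nat (leq0n N) Nn)//= [X in _ + X]big_nat_cond [X in _ + X]big1 ?addr0// => i.
by move=> /andP[/andP[Ni _] _]; rewrite u0// nrm0 expr0n.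
Qed.

Definition finitely_supported (u : nat -> H) N (u0 : forall k, (N <= k)%N -> u k = 0) : HS :=
  HSum (finite_support_summable u0).

Lemma single_support (k : nat) (a : H) i : (k.+1 <= i)%N -> (if i == k then a else 0) = 0.
Proof. by move=> /gtn_eqF ->. Qed.

Definition single (k : nat) (a : H) : HS := finitely_supported (@single_support k a).

Lemma singleE k a i : hcoord (single k a) i = if i == k then a else 0.
Proof. by []. Qed.

Lemma inner_single k a y : inner HS (single k a) y = inner H a (hcoord y k).
Proof.
rewrite -[LHS]/(hinner (single k a) y) /hinner.
apply/(@cvg_lim C^o); first exact: norm_hausdorff.
apply: cvg_near_cst; exists k.+1 => // n /= kn; rewrite /series /=.
rewrite (bigD1_seq k) ?iota_uniq//=; last by rewrite mem_index_iota.
rewrite eqxx big1 ?addr0// => i /negPf ->; exact: inner0l.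
Qed.

Lemma nrm_single k a : nrm (single k a) = nrm a.
Proof.
apply: (@pexpIrn _ 2); rewrite ?nnegrE ?nrm_ge0//; apply: complexI.
by rewrite -!inner_self inner_single singleE eqxx.
Qed.

Lemma singleZ k (c : C) a : single k (c *: a) = c *: single k a.
Proof.
apply: hsum_ext => i; rewrite hcoordZ !singleE.
by case: eqP => // _; rewrite scaler0.
Qed.

Lemma orthogonal_sum_single G k a b : (forall i, G i (0, 0)) ->
  G k (a, b) -> orthogonal_sum G (single k a, single k b).
Proof. by move=> G0 Gab i /=; case: eqP => [->|_]. Qed.

Lemma self_adjoint0 (L : hilbert R) (F : set (L * L)) : self_adjoint F -> F (0, 0).
Proof. by move=> [_ <-] q _; rewrite !inner0r. Qed.

Lemma dense_nrmP (L : hilbert R) (D : set L) :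
  (forall (x : L) (e : R), 0 < e -> exists2 y : L, D y & nrm (x - y) <= e) -> dense D.
Proof.
move=> h O [x Ox] oO.
have /nbhs_ballP[e /= e0 heO] : nbhs x O by exact: open_nbhs_nbhs.
have eE : e = (complex.Re e)%:C.
  by rewrite [LHS]complexE (ger0_Im (ltW e0)) rmorph0 mulr0 addr0.
have r0 : 0 < complex.Re e by rewrite -ltcR -eE.
have [|y Dy xy] := h x (complex.Re e / 2); first by rewrite divr_gt0.
exists y; split=> //; apply: heO; rewrite -ball_normE /ball_ /= nrmE eE ltcR.
by rewrite (le_lt_trans xy)// ltr_pdivrMr// ltr_pMr// ltr1n.
Qed.

Lemma dense_nrm (L : hilbert R) (D : set L) : dense D ->
  forall (x : L) (e : R), 0 < e -> exists2 y : L, D y & nrm (x - y) <= e.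
Proof.
move=> dD x e e0; have e0' : 0 < e%:C by rewrite -[0]/(0%:C) ltcR.
have [||y [xy Dy]] := dD (ball x e%:C).
- by exists x; exact: ballxx.
- exact: ball_open.
exists y => //; move: xy; rewrite -ball_normE /ball_ /= nrmE ltcR; exact: ltW.
Qed.

Lemma square_summable_tail x (e : R) : 0 < e ->
  exists N, forall n, (N <= n)%N -> \sum_(N <= k < n) nrm (hcoord x k) ^+ 2 <= e.
Proof.
move=> e0; have cx : cvgn (series (fun k => nrm (hcoord x k) ^+ 2)) := @hsumP _ _ x.
have /cvgrPdist_le/(_ e e0)[N _ hN] := cx.
exists N => n Nn; have := hN N (leqnn _).
have nd : nondecreasing_seq (series (fun k => nrm (hcoord x k) ^+ 2)).
  apply/nondecreasing_seqP => m.
  by rewrite /series /= big_nat_recr//= lerDl sqr_ge0.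
have := nondecreasing_cvgn_le nd cx n; set l := limn _.
rewrite /series /= (big_cat_nat (leq0n N) Nn)//= => h1.
by rewrite ler_norml => /andP[_]; lra.
Qed.

(** Cut x off at N with squared tail at most e^2 / 2, and approximate the remaining coordinates one
    by one; finite support keeps both the vector and its image square-summable. *)
Lemma orthogonal_sum_dense G : (forall k, G k (0, 0)) ->
  (forall k, dense (op_domain (G k))) -> dense (op_domain (orthogonal_sum G)).
Proof.
move=> G0 dG; apply: dense_nrmP => x e e0.
have e2 : 0 < e ^+ 2 / 2 by rewrite divr_gt0// exprn_gt0.
have [N hN] := square_summable_tail x e2.
(* The N head coordinates share the other e^2 / 2; N + 1 avoids division by zero when N = 0. *)
pose d := Num.sqrt (e ^+ 2 / 2 / N.+1%:R).
have dp : 0 < e ^+ 2 / 2 / N.+1%:R by rewrite divr_gt0.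
have d0 : 0 < d by rewrite sqrtr_gt0.
have approx k : exists zy : H * H, G k zy /\ nrm (hcoord x k - zy.1) <= d.
  have [z [y Gzy] xz] := dense_nrm (dG k) (hcoord x k) d0.
  by exists (z, y).
have [g gP] := choice approx.
pose z k := if (k < N)%N then (g k).1 else 0.
pose y k := if (k < N)%N then (g k).2 else 0.
have z0 k : (N <= k)%N -> z k = 0 by rewrite /z ltnNge => ->.
have y0 k : (N <= k)%N -> y k = 0 by rewrite /y ltnNge => ->.
exists (finitely_supported z0).
  exists (finitely_supported y0) => k /=; rewrite /z /y; case: ltnP => // _.
  by rewrite -surjective_pairing; case: (gP k).
apply: hsum_nrm_le => [|n]; first exact: ltW.
have headle m : (m <= N)%N -> \sum_(0 <= k < m)
    nrm (hcoord (x - finitely_supported z0) k) ^+ 2 <= e ^+ 2 / 2.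
  move=> mN; apply: (@le_trans _ _ (\sum_(0 <= k < m) (e ^+ 2 / 2 / N.+1%:R))).
    rewrite big_nat_cond [leRHS]big_nat_cond; apply: ler_sum => k /andP[/andP[_ km] _].
    have -> : hcoord (x - finitely_supported z0) k = hcoord x k - (g k).1.
      by rewrite -[LHS]/(hcoord x k - z k) /z (leq_trans km).
    rewrite -(sqr_sqrtr (ltW dp)) lerXn2r ?nnegrE ?nrm_ge0 ?(ltW d0)//.
    by case: (gP k).
  rewrite sumr_const_nat subn0 -(mulr_natr _ m) [leLHS]mulrAC ler_pdivrMr// ler_wpM2l ?(ltW e2)//.
  by rewrite ler_nat leqW.
have [nN|/ltnW Nn] := leqP n N.
  by rewrite (le_trans (headle _ nN))//; have := exprn_gt0 2 e0; lra.
rewrite (big_cat_nat (leq0n N) Nn)//=; have := headle N (leqnn _); have := hN n Nn.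
have -> : \sum_(N <= k < n) nrm (hcoord (x - finitely_supported z0) k) ^+ 2 =
          \sum_(N <= k < n) nrm (hcoord x k) ^+ 2.
  rewrite big_nat_cond [RHS]big_nat_cond; apply: eq_bigr => k /andP[/andP[Nk _] _].
  by rewrite -[hcoord (x - _) k]/(hcoord x k - z k) z0// subr0.
lra.
Qed.

(** Testing the adjoint relation on vectors with a single nonzero coordinate recovers it in each
    summand; conversely the two inner product series agree term by term. *)
Lemma orthogonal_sum_self_adjoint G :
  (forall k, self_adjoint (G k)) -> self_adjoint (orthogonal_sum G).
Proof.
move=> saG; have G0 k : G k (0, 0) by exact: self_adjoint0.
split; first by apply: orthogonal_sum_dense => // k; have [] := saG k.
apply/seteqP; split=> [[x y] adj k|[x y] Gxy [z w] Gzw] /=.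
  have [_ <-] := saG k; move=> [a b] Gab /=.
  by have := adj _ (orthogonal_sum_single G0 Gab); rewrite /= !inner_single.
have E : (fun k => inner H (hcoord w k) (hcoord x k) : C^o) =
         (fun k => inner H (hcoord z k) (hcoord y k) : C^o).
  apply/funext => k; have [_ adj] := saG k.
  by have := Gxy k; rewrite -{1}adj => /(_ _ (Gzw k)).
exact: (congr1 (fun u : nat -> C^o => limn (series u)) E).
Qed.

Lemma orthogonal_sum_pure_point G : (forall k, G k (0, 0)) ->
  (forall k, pure_point_spectrum (G k)) -> pure_point_spectrum (orthogonal_sum G).
Proof.
move=> G0 ppG; have [E EP] := choice ppG.
exists [set x | exists k e, E k e /\ x = single k e]; split.
  split.
  - move=> _ [k [e [Ee ->]]]; rewrite inner_single singleE eqxx.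
    by have [[-> //]] := EP k.
  - move=> _ _ [k [e [Ee ->]]] [j [e' [Ee' ->]]] ne.
    rewrite inner_single singleE; case: eqP => [kj|_]; last exact: inner0r.
    subst j; have [[_ orth _] _] := EP k; apply: orth => // ee'.
    by apply: ne; rewrite ee'.
  - move=> x h; apply: hsum_ext => k; have [[_ _ complete] _] := EP k.
    apply: complete => e Ee; have := h _ (ex_intro _ k (ex_intro _ e (conj Ee erefl))).
    by rewrite innerC inner_single -innerC.
move=> _ [k [e [Ee ->]]]; have [_ /(_ _ Ee)[l Gl]] := EP k.
by exists l; rewrite -singleZ; exact: orthogonal_sum_single.
Qed.

Lemma orthogonal_sum_homogeneous G :
  (forall k, homogeneous (G k)) -> homogeneous (orthogonal_sum G).
Proof. by move=> hG a x y Gxy k; have := hG k a _ _ (Gxy k); rewrite -!hsumZ. Qed.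

Lemma orthogonal_sum_bound G (M : R) : (forall k, G k (0, 0)) -> 0 <= M ->
  relation_bound (orthogonal_sum G) M <-> forall k, relation_bound (G k) M.
Proof.
move=> G0 M0; split=> [h k a b Gab|h x y Gxy].
  by have := h _ _ (orthogonal_sum_single G0 Gab); rewrite !nrm_single.
apply: hsum_nrm_le => [|n]; first by rewrite mulr_ge0 ?nrm_ge0.
rewrite exprMn (le_trans _ (ler_wpM2l (sqr_ge0 M) (hsum_partial_le x n)))// mulr_sumr.
apply: ler_sum => k _; rewrite -exprMn lerXn2r ?nnegrE ?mulr_ge0 ?nrm_ge0//.
by apply: h; exact: Gxy.
Qed.
End OrthogonalSum.

Lemma op_graph_self_adjoint (R : realType) (H : hilbert R) (T : H -> H) :
  bounded_self_adjoint T -> self_adjoint (op_graph T).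
Proof.
move=> [_ sT]; split.
  apply: dense_nrmP => x e e0; exists x; last by rewrite subrr nrm0 ltW.
  by exists (T x).
apply/seteqP; split=> [[x y] adj|[x y] + [z w]]; rewrite /op_graph /=.
  by apply: inner_inj => z; rewrite -sT -(adj (z, T z)).
by move=> -> ->.
Qed.

(** * Eigenvectors of finite rank operators *)

Section FiniteRank.
Variables (R : realType) (H : hilbert R).
Local Notation C := R[i].
Implicit Types (T : H -> H).

(** The n + 1 vectors Tx, ..., T^(n+1) x lie in the span of n vectors, so a row of the left kernel
    of their coefficient matrix gives a relation. The factor X is there because x itself need not
    lie in the range. *)
Lemma annihilating_poly T (x : H) : finitely_spanned (range T) ->
  exists2 p : {poly C}, p != 0 & poly_op p T x = 0.
Proof.
move=> [n [v hv]].
have hvi (i : nat) : exists c : 'I_n -> C, iter i.+1 T x = \sum_(j < n) c j *: v j.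
  by apply: hv; exists (iter i T x).
have [c cP] := choice hvi.
pose M : 'M[C]_(n.+1, n) := \matrix_(i, j) c i j.
have kM : kermx M != 0.
  rewrite -mxrank_eq0 mxrank_ker -lt0n subn_gt0 ltnS; exact: rank_leq_col.
have [a aM a0] : exists2 a : 'rV[C]_n.+1, a *m M = 0 & a != 0.
  have [i ri] : exists i, row i (kermx M) != 0.
    apply/existsP; apply: contraNT kM => /existsPn h; apply/eqP/row_matrixP => i.
    by rewrite row0; apply/eqP/negPn/h.
  by exists (row i (kermx M)) => //; rewrite -row_mul mulmx_ker row0.
exists (\poly_(i < n.+1) a 0 (inord i) * 'X).
  rewrite mulf_neq0 ?polyX_eq0//; apply: contraNneq a0 => p0.
  apply/eqP/rowP => i; have := congr1 (fun q : {poly C} => q`_i) p0.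
  by rewrite coef_poly coef0 ltn_ord inord_val mxE.
rewrite poly_opMX (@poly_op_widen _ _ n.+1) ?size_poly//.
transitivity (\sum_(j < n) (a *m M) 0 j *: v j); last first.
  by rewrite aM big1// => j _; rewrite mxE scale0r.
transitivity (\sum_(i < n.+1) \sum_(j < n) (a 0 i * c i j) *: v j).
  apply: eq_bigr => i _; rewrite coef_poly ltn_ord inord_val -iterSr cP scaler_sumr.
  by apply: eq_bigr => j _; rewrite scalerA.
rewrite exchange_big /=; apply: eq_bigr => j _; rewrite mxE scaler_suml.
by apply: eq_bigr => i _; rewrite mxE.
Qed.

(** Strip linear factors T - z from an annihilating product; the first time that what remains does
    not kill x, its value at x is an eigenvector for the factor just removed. *)
Lemma poly_op_eigenvector T (x : H) : linear T -> finitely_spanned (range T) -> x != 0 ->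
  exists (q : {poly C}) (l : C), poly_op q T x != 0 /\
    T (poly_op q T x) = l *: poly_op q T x.
Proof.
move=> lT fT x0; have [p p0 px] := annihilating_poly x fT.
have [r pE] := closed_field_poly_normal p.
have {}px : poly_op (\prod_(z <- r) ('X - z%:P)) T x = 0.
  move: px; rewrite {1}pE poly_opZ// => /eqP; rewrite scaler_eq0 lead_coef_eq0 (negPf p0).
  by move=> /eqP.
elim: r {p p0 pE} px => [|z r ih].
  by rewrite big_nil -polyC1 poly_opC scale1r => /eqP; rewrite (negPf x0).
rewrite big_cons poly_opM// poly_op_XsubC => /eqP; rewrite subr_eq0 => /eqP hz.
have [/ih//|rx] := eqVneq (poly_op (\prod_(z <- r) ('X - z%:P)) T x) 0.
by exists (\prod_(z <- r) ('X - z%:P)), z.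
Qed.

(* Any x orthogonal to a maximal orthonormal family of eigenvectors would yield a
   new eigenvector q(T) x. *)
Lemma finite_rank_pure_point T : finite_rank_self_adjoint T -> pure_point_spectrum (op_graph T).
Proof.
move=> [[[lT _] sT] fT].
pose orthonormal_eigen (E : set H) := [/\ forall e, E e -> inner H e e = 1,
  forall e e', E e -> E e' -> e <> e' -> inner H e e' = 0 &
  forall e, E e -> exists l : C, op_graph T (e, l *: e)].
have [|E [[E1 E2 E3] Emax]] := @Zorn_bigcup H orthonormal_eigen.
  move=> F FP Ftot; split.
  - by move=> e [X /FP[h _ _]]; exact: h.
  - move=> e e' [X FX Xe] [Y FY Ye'].
    have [XY|YX] := Ftot _ _ FX FY.
      by have [_ h _] := FP _ FY; apply: h => //; exact: XY.
    by have [_ h _] := FP _ FX; apply: h => //; exact: YX.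
  - by move=> e [X /FP[_ _ h]]; exact: h.
exists E; split=> //; split=> // x xE; apply/eqP/negPn/negP => x0.
have [q [l [y0 Ty]]] := poly_op_eigenvector lT fT x0.
set y := poly_op q T x in y0 Ty.
(* The complement of a family of eigenvectors is invariant under the symmetric T, so it contains y
   together with x. *)
have yE e : E e -> inner H y e = 0.
  move=> Ee; have [m] := E3 _ Ee; rewrite /op_graph /= => Te.
  have it i : inner H (iter i T x) e = 0.
    by elim: i => [|i ih] /=; [exact: xE|rewrite sT -Te innerZr ih mulr0].
  rewrite /y /poly_op; elim/big_ind: _ => [|u w hu hw|i _].
  - exact: inner0l.
  - by rewrite innerDl hu hw addr0.
  - by rewrite innerZl it mulr0.
have [a a0 ya] := exists_unit y0.
have ayE e : E e -> inner H (a *: y) e = 0 by move=> /yE h; rewrite innerZl h mulr0.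
have nE : ~ E (a *: y).
  by move=> /ayE; rewrite ya => /eqP; rewrite oner_eq0.
apply: (Emax (E `|` [set a *: y])).
  by split=> [e Ee|h]; [left|apply: nE; apply: h; right].
split.
- by move=> e [/E1//|->].
- move=> e e' [Ee|->] [Ee'|->] // ne; first exact: E2.
    by rewrite innerC ayE// rmorph0.
  exact: ayE.
- move=> e [/E3//|->]; exists l.
  by rewrite /op_graph /= (linear_mapZ lT) Ty !scalerA mulrC.
Qed.
End FiniteRank.

(** * Permuting the summands *)

Section CoordinatePermutation.
Variables (R : realType) (H : hilbert R).
Local Notation C := R[i].
Local Notation HS := (hilbert_sum H).
Local Notation HH := (hilbert_sum (hilbert_sum H)).

Definition coord2 (z : HH) (i : nat * nat) : H := hcoord (hcoord z i.1) i.2.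

Lemma coord2_ext (x y : HH) : (forall i, coord2 x i = coord2 y i) -> x = y.
Proof. by move=> xy; apply: hsum_ext => j; apply: hsum_ext => k; exact: (xy (j, k)). Qed.

(** Any finite set of index pairs fits into a square box, where iterated partial sums apply.
    Arbitrary sets are needed because a permutation of pairs does not respect rows. *)
Lemma coord2_sum_le (z : HH) (s : seq (nat * nat)) : uniq s ->
  \sum_(i <- s) nrm (coord2 z i) ^+ 2 <= nrm z ^+ 2.
Proof.
move=> us; pose N := (\max_(i <- s) maxn i.1 i.2).+1.
pose box := [seq (j, k) | j <- index_iota 0 N, k <- index_iota 0 N].
have ubox : uniq box by apply: allpairs_uniq; rewrite ?iota_uniq// => -[? ?] [? ?].
have sbox i : i \in s -> i \in box.
  move=> si; have : (maxn i.1 i.2 < N)%N by rewrite ltnS; exact: leq_bigmax_seq.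
  rewrite gtn_max => /andP[i1 i2]; apply/allpairsP; exists i.
  by rewrite !mem_index_iota/= -surjective_pairing.
have ps : perm_eq s [seq i <- box | i \in s].
  apply: uniq_perm => // [|i]; first exact: filter_uniq.
  by rewrite mem_filter; case: (boolP (i \in s)) => // /sbox ->.
rewrite (perm_big _ ps) big_filter big_mkcond.
apply: (@le_trans _ _ (\sum_(i <- box) nrm (coord2 z i) ^+ 2)).
  by apply: ler_sum => i _; case: ifP => // _; exact: sqr_ge0.
rewrite big_allpairs (le_trans _ (hsum_partial_le z N))//.
by apply: ler_sum => j _; exact: (@hsum_partial_le R H (hcoord z j) N).
Qed.

(** Each row is summable by the bound on boxes; for a fixed number n of rows, m tends to infinity,
    which makes the sequence of rows summable. *)
Lemma coord2_exists (u : nat * nat -> H) (M : R) : 0 <= M ->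
  (forall n m, \sum_(0 <= j < n) \sum_(0 <= k < m) nrm (u (j, k)) ^+ 2 <= M ^+ 2) ->
  exists2 z : HH, (forall i, coord2 z i = u i) & nrm z <= M.
Proof.
move=> M0 uM.
have row_summable j : (fun k => u (j, k)) \in @l2pred R H.
  rewrite inE; apply/square_summableP; exists (M ^+ 2) => n; rewrite /series /=.
  apply: le_trans (uM j.+1 n); rewrite big_nat_recr//= lerDr.
  by apply: sumr_ge0 => i _; apply: sumr_ge0 => k _; exact: sqr_ge0.
pose row j : HS := HSum (row_summable j).
have rowE j : series (fun k => nrm (u (j, k)) ^+ 2) @ \oo --> nrm (row j) ^+ 2.
  have -> : nrm (row j) ^+ 2 = limn (series (fun k => nrm (hcoord (row j) k) ^+ 2)).
    by apply: complexI; rewrite -inner_self -hinner_xx.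
  exact: (@hsumP _ _ (row j)).
have rows_le n : \sum_(0 <= j < n) nrm (row j) ^+ 2 <= M ^+ 2.
  have cv : (fun m => \sum_(0 <= j < n) series (fun k => nrm (u (j, k)) ^+ 2) m) @ \oo -->
      \sum_(0 <= j < n) nrm (row j) ^+ 2.
    elim: n => [|n ih].
      by rewrite big_geq//; under eq_fun do rewrite big_geq//; exact: cvg_cst.
    rewrite big_nat_recr//=; under eq_fun do rewrite big_nat_recr//=.
    by apply: cvgD => //; exact: rowE.
  rewrite -(cvg_lim _ cv)//; apply: limr_le; first by apply/cvg_ex; eexists; exact: cv.
  by apply: nearW => m; exact: uM.
have rows_summable : row \in @l2pred R HS.
  by rewrite inE; apply/square_summableP; exists (M ^+ 2).
by exists (HSum rows_summable); [case|exact: hsum_nrm_le].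
Qed.

(** Injectivity carries a box to a list without repetition. Only an inequality of norms results; for
    a bijection the inverse supplies the other one. *)
Lemma coord2_permute (s : nat * nat -> nat * nat) : injective s -> forall x : HH,
  exists z : HH, (forall i, coord2 z i = coord2 x (s i)) /\ nrm z <= nrm x.
Proof.
move=> injs x; have [|n m|z zE zx] := @coord2_exists (coord2 x \o s) (nrm x).
- exact: nrm_ge0.
- pose box := [seq (j, k) | j <- index_iota 0 n, k <- index_iota 0 m].
  have ubox : uniq box by apply: allpairs_uniq; rewrite ?iota_uniq// => -[? ?] [? ?].
  have := @coord2_sum_le x (map s box); rewrite big_map big_allpairs; apply.
  by rewrite map_inj_uniq.
- by exists z.
Qed.
End CoordinatePermutation.

(** Polarization: |x - y|^2 determines the real part, and replacing x by ix yields the imaginary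
    part. *)
Lemma isometry_inner (R : realType) (K L : hilbert R) (U : K -> L) : linear U ->
  (forall x, nrm (U x) = nrm x) -> forall x y, inner L (U x) (U y) = inner K x y.
Proof.
move=> lU nU.
have ReU x y : complex.Re (inner L (U x) (U y)) = complex.Re (inner K x y).
  have := nrm_sqrB (U x) (U y); have := nrm_sqrB x y.
  rewrite -(linear_mapB lU) !nU; lra.
move=> x y; have := ReU x y; have := ReU ('i *: x) y.
rewrite (linear_mapZ lU) !innerZl.
case: (inner L _ _) => a b; case: (inner K _ _) => c d; simpc => /= h1 h2.
by congr (_ +i* _); move: h1 h2; lra.
Qed.

Lemma permuted_unitarily_equivalent (R : realType) (H : hilbert R)
    (T T' : nat -> nat -> H -> H) (s s' : nat * nat -> nat * nat) :
  cancel s s' -> cancel s' s -> (forall i, T' i.1 i.2 = T (s i).1 (s i).2) ->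
  unitarily_equivalent (double_orthogonal_sum T) (double_orthogonal_sum T').
Proof.
move=> ss' s's TT'.
have [U UP] := choice (@coord2_permute R H _ (can_inj ss')).
have [V VP] := choice (@coord2_permute R H _ (can_inj s's)).
have VU x : V (U x) = x.
  by apply: coord2_ext => i; rewrite (VP _).1 (UP _).1 s's.
have UV x : U (V x) = x.
  by apply: coord2_ext => i; rewrite (UP _).1 (VP _).1 ss'.
have lU : linear U.
  move=> a x y; apply: coord2_ext => i; rewrite (UP _).1.
  by rewrite /coord2 !hsumD !hsumZ -!/(coord2 _ _) !(UP _).1.
exists U; split=> //.
- apply: isometry_inner => // x; apply/eqP; rewrite eq_le (UP _).2.
  by rewrite -{1}(VU x) (VP _).2.
- by apply/seteqP; split=> // x _; exists (V x).
- move=> x y; rewrite /double_orthogonal_sum /orthogonal_sum /op_graph /=.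
  split=> h j k.
    rewrite -[hcoord _ k]/(coord2 (U y) (j, k)) -[hcoord (hcoord (U x) j) k]/(coord2 (U x) (j, k)).
    by rewrite !(UP _).1 (TT' (j, k)); exact: h.
  have := h (s' (j, k)).1 (s' (j, k)).2.
  rewrite -[hcoord _ _]/(coord2 (U y) (s' (j, k))).
  rewrite -[hcoord (hcoord (U x) _) _]/(coord2 (U x) (s' (j, k))).
  by rewrite !(UP _).1 TT' s's.
Qed.

(** All fibers over D are infinite subsets of a countable set, hence equipotent; bijections chosen
    fiber by fiber glue to a permutation of the indices. *)
Lemma infinite_fibers_bijection (T : Type) (D : set T) (g g' : nat * nat -> T) :
  (forall i, D (g i)) -> (forall i, D (g' i)) ->
  (forall a, D a -> infinite_set [set i | g i = a]) ->
  (forall a, D a -> infinite_set [set i | g' i = a]) ->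
  exists s s' : nat * nat -> nat * nat,
    [/\ cancel s s', cancel s' s & forall i, g' i = g (s i)].
Proof.
move=> gD g'D ginf g'inf.
have bij a : exists f : nat * nat -> nat * nat, D a ->
    set_bij [set i | g' i = a] [set i | g i = a] f.
  have [Da|nD] := pselect (D a); last by exists id.
  have eqa : ([set i | g' i = a] #= [set i | g i = a])%card.
    apply: (@card_eq_trans _ nat _ _ [set: nat]).
      by apply: eq_card_nat => //; exact: g'inf.
    by rewrite card_eq_sym; apply: eq_card_nat => //; exact: ginf.
  by have /card_set_bijP[f hf] := eqa; exists f.
have [f fP] := choice bij.
pose s i := f (g' i) i.
have gs i : g (s i) = g' i by have [h _ _] := fP _ (g'D i); exact: h.
have injs : injective s.
  move=> i j sij; have gij : g' i = g' j by rewrite -!gs sij.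
  have [_ inj _] := fP _ (g'D i); apply: inj; rewrite ?inE//=.
  by move: sij; rewrite /s gij.
have surs i : exists j, s j = i.
  have [_ _ /(_ i erefl)[j /= ji fj]] := fP _ (gD i).
  by exists j; rewrite /s ji.
have [s' s's] := choice surs.
by exists s, s'; split=> // i; apply: injs; rewrite s's.
Qed.

Lemma unbounded_infinite (T : eqType) (h : T -> nat) (F : set T) :
  (forall N, exists2 i, F i & (N <= h i)%N) -> infinite_set F.
Proof.
move=> hF /finite_seqP[s sE]; pose N := (\max_(i <- s) h i)%N; have [i Fi] := hF N.+1.
rewrite ltnNge => /negP; apply; apply: leq_bigmax_seq => //.
by move: Fi; rewrite sE.
Qed.

(** * The dense family *)

Section DenseFamily.
Variables (R : realType) (H : hilbert R).
Local Notation C := R[i].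

Lemma finite_rank_perturbation (A : H -> H) (h : H) (s : R) : finite_rank_self_adjoint A ->
  finite_rank_self_adjoint (fun x => A x + (s%:C * inner H x h) *: h).
Proof.
move=> [[[lA cA] sA] fA]; split; last first.
  apply: (finitely_spanned_add fA (h := h)) => _ [x _ <-].
  by exists (A x), (s%:C * inner H x h); split=> //; exists x.
have lT : linear (fun x => A x + (s%:C * inner H x h) *: h).
  move=> a x y; rewrite lA innerDl innerZl scalerDr scalerA addrACA -scalerDl.
  by rewrite mulrDr mulrCA.
split; last first.
  move=> x y; rewrite innerDl innerDr sA innerZl innerZr rmorphM /= conj_real -innerC.
  by congr (_ + _); rewrite -!mulrA; congr (_ * _); rewrite mulrC.
split=> //; have [M M0 hM] := linear_continuous_bound lA cA.
apply: (@linear_bound_continuous _ _ _ (M + `|s| * nrm h * nrm h)) => // x.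
rewrite (le_trans (nrmD _ _))// mulrDl lerD// nrmZ mulrAC ler_wpM2r ?nrm_ge0//.
rewrite -lecR Re_normC normrM (_ : `|s%:C| = `|s|%:C); last by rewrite -Re_norm_real Re_normC.
by rewrite -mulrA (mulrC (nrm h)) [leRHS]rmorphM /= ler_wpM2l ?ler0c// inner_norm_le.
Qed.

Lemma infinite_dimensional_unit : infinite_dimensional H -> exists h : H, nrm h = 1.
Proof.
move=> Hinf; have [x x0] : exists x : H, x != 0.
  apply: contrapT => h; apply: Hinf; exists 0%N, (fun=> 0) => x _.
  exists (fun=> 0); rewrite big_ord0; apply/eqP/negPn/negP => x0.
  by apply: h; exists x.
have [a _ ha] := exists_unit x0; exists (a *: x).
have n2 : nrm (a *: x) ^+ 2 = 1 by apply: (@complexI R); rewrite -inner_self ha.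
by apply/eqP; rewrite -(@pexpr_eq1 _ _ 2) ?nrm_ge0// n2.
Qed.

(** Take B in [K0] within m / 4 of A + (m / 2) <., h> h, with h a unit vector. Then |Ah - Bh| lies
    between m / 4 and 3 m / 4, a range that no [R_ j] with j < N attains, while |A - B| <= 3 m / 4 <
    t because m <= t / 2. *)
Lemma dense_family_near (K0 : set (H -> H)) (R_ : nat -> H -> H) (A : H -> H) (t : R) (N : nat) :
  infinite_dimensional H -> K0 `<=` @finite_rank_self_adjoint R H ->
  (forall A : H -> H, finite_rank_self_adjoint A -> forall e : R, 0 < e ->
     exists B : H -> H, K0 B /\ (op_norm (op_graph (A - B)%R) < e%:E)%E) ->
  range R_ = K0 -> K0 A -> 0 < t ->
  exists2 j, (N <= j)%N & (op_norm (op_graph (A - R_ j)%R) < t%:E)%E.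
Proof.
move=> Hinf K0_sub K0_dense R_enum K0A t0.
have [h h1] := infinite_dimensional_unit Hinf.
pose g j := nrm (A h - R_ j h).
(* The finitely many distances g j, j < N, avoid some interval (0, m). *)
have [m m0 [mt hm]] : exists2 m : R, 0 < m &
    m <= t / 2 /\ forall j, (j < N)%N -> g j = 0 \/ m <= g j.
  elim: N => [|n [m m0 [mt hm]]]; first by exists (t / 2); rewrite ?divr_gt0.
  have [gn0|gn0] := eqVneq (g n) 0.
    exists m => //; split=> // j; rewrite ltnS leq_eqVlt => /orP[/eqP->|/hm//].
    by left.
  exists (Num.min m (g n)); first by rewrite lt_min m0 lt_neqAle eq_sym gn0 nrm_ge0.
  split=> [|j]; first by rewrite ge_min mt.
  rewrite ltnS leq_eqVlt => /orP[/eqP->|/hm[->|mg]]; [right|by left|right].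
    by rewrite ge_min lexx orbT.
  by rewrite ge_min mg.
have Af := K0_sub _ K0A; have [[[lA _] _] _] := Af.
have Tf := finite_rank_perturbation h (m / 2) Af; set T := (X in finite_rank_self_adjoint X) in Tf.
have [[[lT _] _] _] := Tf.
have [|B [K0B hB]] := K0_dense _ Tf (m / 4); first by rewrite divr_gt0.
have [[[lB _] _] _] := K0_sub _ K0B.
have [j _ jB] : range R_ B by rewrite R_enum.
have /(operator_norm_ltP _ (linear_sub lT lB))[c /andP[_ /ltW cm] /(operator_bound_le cm) TB] := hB.
have AT : operator_bound (A - T)%R (m / 2).
  move=> x; rewrite fun_subE /T opprD addrA subrr sub0r nrmN nrmZ h1 mulr1.
  rewrite -lecR Re_normC normrM [leRHS]rmorphM /= ler_pM//.
    by rewrite -Re_normC Re_norm_real lecR ger0_norm// divr_ge0 ?(ltW m0).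
  by rewrite (le_trans (inner_norm_le _ _))// h1 mulr1.
exists j.
  rewrite leqNgt; apply/negP => /hm; rewrite /g jB.
  have := TB h; rewrite fun_subE h1 mulr1.
  have ATh : nrm (A h - T h) = m / 2.
    rewrite /T opprD addrA subrr sub0r nrmN inner_self h1 expr1n mulr1 nrmZr h1 mulr1.
    by rewrite ger0_norm// divr_ge0 ?(ltW m0).
  have := nrm_distD (T h) (A h) (B h); have := nrm_distD (B h) (A h) (T h).
  rewrite (nrm_dist (B h)) ATh => h2 h3 h4 [h5|h5]; move: h2 h3 h4 m0 h5; lra.
rewrite jB; apply/operator_norm_ltP; first exact: linear_sub.
exists (m / 2 + m / 4); first by apply/andP; split; move: m0 mt t0; lra.
exact: operator_bound_distD AT TB.
Qed.
End DenseFamily.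

Theorem theorem9p3 (R : realType) (H : hilbert R)
  (H_sep : separable H) (H_inf : infinite_dimensional H)
  (K0 : set (H -> H))
  (K0_sub : K0 `<=` @finite_rank_self_adjoint R H)
  (K0_countable : countable K0)
  (K0_dense : forall A : H -> H, finite_rank_self_adjoint A ->
     forall e : R, 0 < e ->
       exists B : H -> H, K0 B /\ (op_norm (op_graph (A - B)%R) < e%:E)%E)
  (R_ : nat -> H -> H) (R_enum : range R_ = K0)
  (Rt : R -> nat -> nat -> H -> H)
  (Rt_enum : forall (t : R) (j : nat), 0 < t ->
     range (Rt t j) =
       [set A | K0 A /\ (op_norm (op_graph (A - R_ j)%R) < t%:E)%E])
  (R0_def : forall j k : nat, Rt 0 j k = R_ j) :
  let A := fun t : R => double_orthogonal_sum (Rt t) in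
  [/\ (forall t : R, 0 <= t -> self_adjoint (A t)),
      (forall s t : R, 0 <= s -> 0 <= t -> unitarily_equivalent (A s) (A t)),
      (forall t : R, 0 <= t -> pure_point_spectrum (A t)) &
      (forall f : R -> R[i]^o, continuous f -> forall t : R, 0 < t ->
         op_norm (double_orthogonal_sum (fun j k : nat =>
             functional_calculus f (Rt t j k) - functional_calculus f (Rt 0 j k)))
         = operator_modulus f t)].
Proof.
move=> A.
have Rt_K0 t j k : 0 <= t -> K0 (Rt t j k).
  rewrite le_eqVlt => /orP[/eqP<-|t0]; first by rewrite R0_def -R_enum; exists j.
  by have : range (Rt t j) (Rt t j k) by []; rewrite Rt_enum// => -[].
have Rt_frsa t j k (t0 : 0 <= t) := K0_sub _ (Rt_K0 t j k t0).
have Rt0 t i : 0 <= t -> forall k, op_graph (Rt t i k) (0, 0).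
  move=> t0 k; have [[[lT _] _] _] := Rt_frsa t i k t0.
  by rewrite /op_graph /= (linear_map0 lT).
have fibers t : 0 <= t -> forall B, K0 B ->
    infinite_set [set i : nat * nat | Rt t i.1 i.2 = B].
  move=> t0 B K0B; move: t0; rewrite le_eqVlt => /orP[/eqP<-|t0].
    (* At t = 0 the repetition comes from the second index, along which [R_ j] is constant; for t >
       0 it comes from the first. *)
    have [j _ jB] : range R_ B by rewrite R_enum.
    by apply: (@unbounded_infinite _ snd) => N; exists (j, N); rewrite //= R0_def.
  apply: (@unbounded_infinite _ fst) => N.
  have [j Nj Bj] := dense_family_near N H_inf K0_sub K0_dense R_enum K0B t0.
  have [k _ kB] : range (Rt t j) B by rewrite Rt_enum.
  by exists (j, k).
split.
- move=> t t0; apply: orthogonal_sum_self_adjoint => j; apply: orthogonal_sum_self_adjoint => k.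
  by apply: op_graph_self_adjoint; case: (Rt_frsa t j k t0).
- move=> r t r0 t0.
  have [||||s [s' [ss' s's hs]]] := @infinite_fibers_bijection _ K0
    (fun i => Rt r i.1 i.2) (fun i => Rt t i.1 i.2).
  + by move=> i; exact: Rt_K0.
  + by move=> i; exact: Rt_K0.
  + exact: fibers.
  + exact: fibers.
  exact: permuted_unitarily_equivalent ss' s's hs.
- move=> t t0; apply: orthogonal_sum_pure_point => [j k|j]; first exact: Rt0.
  apply: orthogonal_sum_pure_point => k; first exact: Rt0.
  by apply: finite_rank_pure_point; exact: Rt_frsa.
- move=> f cf t t0; set D := fun j k => functional_calculus f (Rt t j k) - _.
  have lD j k : linear (D j k) by apply: linear_sub; exact: functional_calculus_linear.
  have D0 j k : op_graph (D j k) (0, 0) by rewrite /op_graph /= (linear_map0 (lD j k)).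
  have hD : homogeneous (double_orthogonal_sum D).
    apply: orthogonal_sum_homogeneous => j; apply: orthogonal_sum_homogeneous => k.
    exact: op_graph_homogeneous.
  have boundD M : 0 <= M ->
      (op_norm (double_orthogonal_sum D) <= M%:E)%E <-> forall j k, operator_bound (D j k) M.
    move=> M0; rewrite op_norm_leP// orthogonal_sum_bound//.
    have E j : relation_bound (orthogonal_sum (fun k => op_graph (D j k))) M <->
        forall k, relation_bound (op_graph (D j k)) M by exact: orthogonal_sum_bound.
    split=> [h j k x|h j]; first exact: ((E j).1 (h j) k x).
    by apply/E => k x y; rewrite /op_graph /= => ->; exact: h.
  have D_ge0 : (0 <= op_norm (double_orthogonal_sum D))%E.
    by apply: op_norm_ge0 => j k; exact: D0.
  apply/eqP; rewrite eq_le; apply/andP; split.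
    have modulus_ge j k : (op_norm (op_graph (D j k)) <= operator_modulus f t)%E.
      apply: ereal_sup_ubound; exists H, (Rt t j k), (Rt 0 j k); split=> //.
      - by case: (Rt_frsa t j k (ltW t0)).
      - by case: (Rt_frsa 0 j k (lexx _)).
      - have : range (Rt t j) (Rt t j k) by [].
        by rewrite R0_def Rt_enum// => -[_ /ltW].
    have := @op_norm_ge0 _ _ _ (D0 0%N 0%N) => /le_trans/(_ (modulus_ge 0%N 0%N)).
    case: (operator_modulus f t) modulus_ge => [M hM M0||]; last 2 first.
    + by move=> _ _; rewrite leey.
    + by move=> _; rewrite leNgt ltNy0.
    apply/boundD => // j k.
    by apply/operator_norm_leP => //; exact: hM.
  case DE : (op_norm (double_orthogonal_sum D)) D_ge0 => [M||] M0; last 2 first.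
  + by rewrite leey.
  + by move: M0; rewrite leNgt ltNy0.
  have DM := (boundD M M0).1 ltac:(by rewrite DE).
  apply: ge_ereal_sup => _ [K [S [T [bS bT ST ->]]]].
  apply/operator_norm_leP => //; first by apply: linear_sub; exact: functional_calculus_linear.
  apply: (functional_calculus_modulus H_inf K0_sub K0_dense cf t0 M0 _ bS bT ST).
  move=> P Q K0P K0Q PQ.
  (* Every pair P, Q of [K0] at distance less than t is a summand: Q is some [R_ j], and P is then
     listed in [Rt t j]. *)
  have [j _ jQ] : range R_ Q by rewrite R_enum.
  have [k _ kP] : range (Rt t j) P by rewrite Rt_enum// jQ.
  by rewrite -kP -jQ -(R0_def j k); exact: DM.
Qed.
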